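(* Let $p>5$ be a prime, $q=p^h$, and let $\mathcal{F}$ be the projective closure of the affine curve $ax^n+by^m=1$ defined over $\mathbb{F}_q$, where $a,b\in\mathbb{F}_q^*$ and $m,n$ are positive integers with $n\ge m>2$ and $p\nmid mn$. Suppose $\mathcal{F}$ is classical with respect to lines ($\Sigma_1$). Then $\mathcal{F}$ is $\mathbb{F}_q$-Frobenius nonclassical with respect to conics ($\Sigma_2$) if and only if one of the following holds: (a) $p\mid(n-2)$ and $m=n=\frac{2(q-1)}{p^r-1}$ for some $r<h$ with $r\mid h$, and $a,b\in\mathbb{F}_{p^r}$; (b) $p\mid(2n-1)$ and $m=n=\frac{q-1}{2(p^r-1)}$ for some $r<h$ with $r\mid h$, and $a^2,b^2\in\mathbb{F}_{p^r}$; (c) $p\mid(n+1)$, $q=n+1=m+1$ and $a+b=1$; (d) $p\mid(n-1)$ and $n=2m=\frac{q-1}{p^r-1}$ for some $r<h$ with $r\mid h$, and either $a,b\in\mathbb{F}_{p^r}$, or $2r\mid h$, $a\in\mathbb{F}_{p^r}$, $b\in\mathbb{F}_{p^{2r}}$ with $b^{p^r}=-b$; (e) $p\mid(n-2)$ and $n=2m=\frac{2(q-1)}{p^r-1}$ for some $r<h$ with $r\mid h$, and $a,b\in\mathbb{F}_{p^r}$.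
   Context: For a geometrically irreducible projective plane curve $\mathcal{F}$ over $\mathbb{F}_q$ with function field $\overline{\mathbb{F}}_q(x,y)$ and $s\ge1$, let $\Sigma_s$ be the linear system of plane curves of degree $s$, $M=\binom{s+2}{2}-1$, and $\varphi_0,\dots,\varphi_M$ the monomials of degree $s$ in $x,y,1$. With $\tau$ a separating element and $D^{(k)}_\tau$ Hasse derivatives, the order sequence $\varepsilon_0<\dots<\varepsilon_M$ is the lexicographically smallest sequence with $\det(D_\tau^{(\varepsilon_i)}\varphi_j)\ne0$; $\mathcal{F}$ is classical w.r.t. $\Sigma_s$ if $\varepsilon_i=i$ for all $i$. The $\mathbb{F}_q$-Frobenius order sequence $\nu_0<\dots<\nu_{M-1}$ is the lexicographically smallest sequence such that the $(M+1)\times(M+1)$ determinant with first row $(\varphi_0^q,\dots,\varphi_M^q)$ and further rows $(D^{(\nu_i)}_\tau\varphi_0,\dots,D^{(\nu_i)}_\tau\varphi_M)$, $i=0,\dots,M-1$, is nonzero; $\mathcal{F}$ is $\mathbb{F}_q$-Frobenius classical w.r.t. $\Sigma_s$ if $\nu_i=i$ for all $i$, and $\mathbb{F}_q$-Frobenius nonclassical otherwise. $\Sigma_1$ = lines, $\Sigma_2$ = conics. *)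

(* Defs.v *)
From HB Require Import structures.
From mathcomp Require Import all_boot all_order all_algebra.
Set Implicit Arguments. Unset Strict Implicit. Unset Printing Implicit Defensive.
Import GRing.Theory.
Local Open Scope ring_scope.

(* Exponents (i, j) of the monomials x^i y^j (times 1^(s-i-j)) of degree s
   in x, y, 1, i.e. the (affine, dehomogenised) generators of Sigma_s. *)
Definition monos (s : nat) : seq (nat * nat) :=
  flatten [seq [seq (i, j) | j <- iota 0 (s - i).+1] | i <- iota 0 s.+1].

Definition nmonos (s : nat) : nat := size (monos s).

Fixpoint lex_le (u v : seq nat) : bool :=
  match u, v with
  | a :: u', b :: v' => (a < b)%N || ((a == b) && lex_le u' v')
  | _, _ => true
  end.

Section FunctionField.
Variables (F : fieldType) (K : fieldType) (emb : F -> K).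

Definition hasse_derivation (t : K) (D : nat -> K -> K) : Prop :=
  [/\ forall f, D 0%N f = f,
      forall k f g, D k (f + g) = D k f + D k g,
      forall k f g, D k (f * g) = \sum_(i < k.+1) D i f * D (k - i)%N g,
      forall k c, (0 < k)%N -> D k (emb c) = 0 &
      forall i j f, D i (D j f) = ('C(i + j, i))%:R * D (i + j)%N f]
  /\ (D 1%N t = 1 /\ forall k, (1 < k)%N -> D k t = 0).

Variables (D : nat -> K -> K) (x y : K).

Definition phi (s : nat) (j : nat) : K :=
  let e := nth (0, 0)%N (monos s) j in x ^+ e.1 * y ^+ e.2.

Definition order_mx (s : nat) (eps : seq nat) : 'M[K]_(nmonos s) :=
  \matrix_(i < nmonos s, j < nmonos s) D (nth 0%N eps i) (phi s j).

Definition frob_mx (q s : nat) (nu : seq nat) : 'M[K]_(nmonos s) :=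
  \matrix_(i < nmonos s, j < nmonos s)
    if i == 0 :> nat then phi s j ^+ q else D (nth 0%N nu i.-1) (phi s j).

Definition is_order_seq (s : nat) (eps : seq nat) : Prop :=
  [/\ size eps = nmonos s, sorted ltn eps, \det (order_mx s eps) != 0 &
      forall eps', size eps' = nmonos s -> sorted ltn eps' ->
        \det (order_mx s eps') != 0 -> lex_le eps eps'].

Definition is_frob_order_seq (q s : nat) (nu : seq nat) : Prop :=
  [/\ size nu = (nmonos s).-1, sorted ltn nu, \det (frob_mx q s nu) != 0 &
      forall nu', size nu' = (nmonos s).-1 -> sorted ltn nu' ->
        \det (frob_mx q s nu') != 0 -> lex_le nu nu'].

Definition classical (s : nat) : Prop := is_order_seq s (iota 0 (nmonos s)).

Definition frob_classical (q s : nat) : Prop :=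
  is_frob_order_seq q s (iota 0 (nmonos s).-1).
Definition frob_nonclassical (q s : nat) : Prop := ~ frob_classical q s.

End FunctionField.

(* c lies in the subfield F_{p^r} of F_q (for r | h) *)
Definition in_subfield (F : finFieldType) (p r : nat) (c : F) : bool :=
  c ^+ (p ^ r) == c.

(* Main.v *)
(** Write y_k for the k-th Hasse derivative of y. The osculating conic at a
point, written in the coordinates X (along x) and Z (distance to the tangent),
is G = - y_2^4 X^2 + y_2^3 Z - y_2^2 y_3 X Z + (y_3^2 - y_2 y_4) Z^2 = 0, and
the curve is Frobenius nonclassical for conics iff G vanishes at the Frobenius
image. Since x^q and y^q are constants for D_1, differentiating this identity
gives Monge's equation y_2^2 y_5 - 3 y_2 y_3 y_4 + 2 y_3^3 = 0.

On the Fermat curve Monge's expression is, up to a nonzero factor, a binary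
sextic in u = a x^n and v = b y^m whose coefficients are polynomials in n and m.
It vanishes iff (n, m) is mod p one of the nine pairs for which x^n + y^m = 1
is formally a conic. In each of them the osculating conic is explicit, with
coefficients killed by D_1, and the Frobenius condition becomes a second Fermat
relation alpha x^N + beta y^M = 1. Such a relation must be a p^s-th power of the
equation of the curve, which determines n, m and the fields containing a, b. *)
Require Import Defs.
From HB Require Import structures.
From mathcomp Require Import all_boot all_order all_algebra.
From mathcomp Require Import finfield.
From mathcomp Require Import ring zify.
Set Implicit Arguments. Unset Strict Implicit. Unset Printing Implicit Defensive.
Import GRing.Theory.
Local Open Scope ring_scope.

Lemma lex_le_iota (k : nat) (s : seq nat) :
  sorted ltn s -> all (leq k) s -> lex_le (iota k (size s)) s.
Proof.
elim: s k => [|a s IHs] k //= pas /andP[ka _].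
case: (ltngtP k a) ka => //= -> _; apply: IHs; first exact: path_sorted pas.
exact: order_path_min ltn_trans pas.
Qed.

(** * Calculus of Hasse derivatives and the Frobenius determinant *)

Section HasseDerivation.

Variables (F K : fieldType) (emb : {rmorphism F -> K}) (x y : K).
Variable D : nat -> K -> K.
Hypothesis hasseD : hasse_derivation emb x D.

Lemma hasse0 f : D 0 f = f. Proof. by case: hasseD => -[]. Qed.

Lemma hasseDD k f g : D k (f + g) = D k f + D k g.
Proof. by case: hasseD => -[]. Qed.

Lemma hasseM k f g : D k (f * g) = \sum_(i < k.+1) D i f * D (k - i) g.
Proof. by case: hasseD => -[]. Qed.

Lemma hasse_emb k c : (0 < k)%N -> D k (emb c) = 0.
Proof. by case: hasseD => -[_ _ _ H _] _; apply: H. Qed.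

Lemma hasse_comp i j f : D i (D j f) = 'C(i + j, i)%:R * D (i + j) f.
Proof. by case: hasseD => -[]. Qed.

Lemma hasse_x1 : D 1 x = 1. Proof. by case: hasseD => _ []. Qed.

Lemma hasse_x k : (1 < k)%N -> D k x = 0.
Proof. by case: hasseD => _ [_ H]; apply: H. Qed.

Lemma hasse_zero k : D k 0 = 0.
Proof. by apply: (addrI (D k 0)); rewrite -hasseDD !addr0. Qed.

Lemma hasse_one k : (0 < k)%N -> D k 1 = 0.
Proof. by move=> k0; rewrite -(rmorph1 emb) hasse_emb. Qed.

Lemma hasse_sum k n (f : 'I_n -> K) :
  D k (\sum_(i < n) f i) = \sum_(i < n) D k (f i).
Proof. exact: (big_morph _ (hasseDD k) (hasse_zero k)). Qed.

Lemma deriveM f g : D 1 (f * g) = D 1 f * g + f * D 1 g.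
Proof. by rewrite hasseM !big_ord_recl big_ord0 /= !hasse0 addr0 addrC. Qed.

Lemma deriveN f : D 1 (- f) = - D 1 f.
Proof. by apply: (addrI (D 1 f)); rewrite -hasseDD !subrr hasse_zero. Qed.

Lemma derive_nat n : D 1 n%:R = 0.
Proof. by rewrite -(rmorph_nat emb) hasse_emb. Qed.

Lemma deriveX f n : D 1 (f ^+ n) = n%:R * f ^+ n.-1 * D 1 f.
Proof.
elim: n => [|n IHn]; first by rewrite hasse_one // !mul0r.
rewrite exprS deriveM IHn; case: n {IHn} => [|n] /=; first by rewrite expr0; ring.
by rewrite !exprS -[n.+2]addn1 natrD; ring.
Qed.

Lemma derive_hasse k f : D 1 (D k f) = k.+1%:R * D k.+1 f.
Proof. by rewrite hasse_comp add1n bin1. Qed.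

Section Constants.
Variable p : nat.
Hypothesis pcharKp : p \in [pchar K].

(** Composing [D k] with [D 1] gives (k+1) times [D k.+1], and k+1 is invertible below p. So in
    orders below p a constant of [D 1] behaves like a scalar. *)
Lemma hasse_const k c : (0 < k < p)%N -> D 1 c = 0 -> D k c = 0.
Proof.
case: k => // k /= kp dc.
have /eqP : k.+1%:R * D k.+1 c = 0.
  by have := hasse_comp k 1 c; rewrite dc hasse_zero addn1 binSn => <-.
rewrite mulf_eq0 -(dvdn_pcharf pcharKp) => /orP[|/eqP//].
by move=> /(dvdn_leq (ltn0Sn k)); rewrite leqNgt kp.
Qed.

Lemma hasse_constM k c f : (k < p)%N -> D 1 c = 0 -> D k (c * f) = c * D k f.
Proof.
move=> kp dc; rewrite hasseM big_ord_recl /= subn0 hasse0 big1 ?addr0 // => i _.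
by rewrite hasse_const ?mul0r // /bump /= (leq_ltn_trans _ kp) // ltn_ord.
Qed.

Lemma derive_emb_expr c f n : (p %| n)%N -> D 1 (emb c * f ^+ n) = 0.
Proof.
rewrite (dvdn_pcharf pcharKp) => /eqP n0.
by rewrite deriveM deriveX hasse_emb // n0 !mul0r mulr0 addr0.
Qed.

End Constants.

(** The coefficients are numbered in the order of [monos 2], namely 1, y, y^2, x, xy, x^2. *)
Definition conic (c : nat -> K) (X Y : K) : K :=
  c 0%N + c 1%N * Y + c 2%N * Y ^+ 2 + c 3%N * X + c 4%N * (X * Y) + c 5%N * X ^+ 2.

(** A linear relation between the columns is a conic: the first row says that it passes through the
    Frobenius image, the other five that it meets the curve at (x, y) to order at least 5. *)
Lemma frob_mx_det0P q :
  \det (frob_mx D x y q 2 (iota 0 5)) = 0 <->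
  exists c : nat -> K, [/\ exists2 j, (j < 6)%N & c j != 0,
    \sum_(j < nmonos 2) c j * phi x y 2 j ^+ q = 0 &
    forall i, (i < 5)%N -> \sum_(j < nmonos 2) c j * D i (phi x y 2 j) = 0].
Proof.
have nth_iota5 i : (i < 5)%N -> nth 0%N (iota 0 5) i = i by move=> ?; rewrite nth_iota.
split=> [det0|[c [[j j6 cj] c0 ci]]].
  (* [det0P] produces left kernel vectors, hence the transpose. *)
  have /eqP/det0P[w w0 /matrixP wA] : \det (frob_mx D x y q 2 (iota 0 5))^T = 0.
    by rewrite det_tr.
  pose W k := w 0 (inord k : 'I_6); exists W.
  have WE (j : 'I_(nmonos 2)) : W j = w 0 j by rewrite /W inord_val.
  have rowE (i : 'I_(nmonos 2)) : \sum_(j < nmonos 2) W j *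
      (if i == 0%N :> nat then phi x y 2 j ^+ q else D (nth 0%N (iota 0 5) i.-1) (phi x y 2 j)) = 0.
    have := wA 0 i; rewrite !mxE; apply: etrans; apply: eq_bigr => j _.
    by rewrite WE !mxE.
  split; last 1 first.
  - move=> i i5; have := rowE (Ordinal (i5 : (i.+1 < 6)%N)).
    by rewrite -[Ordinal _ == 0%N :> nat]/false [(Ordinal _).-1]/= nth_iota5.
  - have /existsP[j wj] : [exists j : 'I_(nmonos 2), w 0 j != 0].
      apply: contraNT w0 => /existsPn w0; apply/eqP/rowP => j.
      by rewrite mxE; apply/eqP; have := w0 j; rewrite negbK.
    by exists j; rewrite // WE.
  - exact: (rowE 0).
apply/eqP; rewrite -det_tr; apply/det0P.
exists (\row_(k < nmonos 2) c k).
  apply: contraNneq cj => /rowP/(_ (Ordinal (j6 : (j < nmonos 2)%N))).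
  by rewrite !mxE => ->.
apply/rowP => -[i i6]; rewrite !mxE.
case: i i6 => [|i] i6.
  apply: etrans c0; apply: eq_bigr => k _; rewrite !mxE; reflexivity.
apply: etrans (ci i _) => //; apply: eq_bigr => k _; rewrite !mxE.
  by rewrite [_.-1]/= nth_iota5.
Qed.

(** The sequence 0, ..., 4 is lexicographically least among increasing sequences of its length, so
    minimality is automatic and only the determinant decides. *)
Lemma frob_nonclassicalE q :
  frob_nonclassical D x y q 2 <-> \det (frob_mx D x y q 2 (iota 0 5)) = 0.
Proof.
split=> [nc|det0 [_ _]]; last by rewrite [iota _ _]/(iota 0 5) det0 eqxx.
apply/eqP; apply/negPn/negP => detN0; apply: nc; split=> //= s sz_s s_sorted _.
by have := @lex_le_iota 0 s s_sorted; rewrite sz_s; apply; apply/allP.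
Qed.

(** The last row of the order matrix for lines is ([D 2 1], [D 2 y], [D 2 x]), whose outer entries
    vanish; with [D 2 y = 0] the whole row would be zero. *)
Lemma classical_lines_hasse2 : classical D x y 1 -> D 2 y != 0.
Proof.
case=> _ _ + _; apply: contraNneq => y2; apply/det0P.
exists (delta_mx 0 (Ordinal (isT : (2 < nmonos 1)%N))).
  by apply/eqP => /matrixP/(_ 0 (Ordinal (isT : (2 < nmonos 1)%N)));
    rewrite !mxE !eqxx => /eqP; rewrite oner_eq0.
rewrite -rowE; apply/rowP => -[[|[|[|//]]] j3]; rewrite !mxE /phi /= ?expr0 ?expr1 ?mul1r ?mulr1.
- exact: hasse_one.
- exact: y2.
- exact: hasse_x.
Qed.

Lemma sum_phi2 (g : K -> K) (c : nat -> K) :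
  \sum_(j < nmonos 2) c j * g (phi x y 2 j) =
  c 0%N * g 1 + c 1%N * g y + c 2%N * g (y ^+ 2) +
  c 3%N * g x + c 4%N * g (x * y) + c 5%N * g (x ^+ 2).
Proof.
rewrite -[nmonos 2]/6%N !big_ord_recl big_ord0 /= addr0 !addrA /phi /=.
by rewrite !expr0 !expr1 !mul1r !mulr1.
Qed.

Lemma sum_phi2_pow q (c : nat -> K) :
  \sum_(j < nmonos 2) c j * phi x y 2 j ^+ q = conic c (x ^+ q) (y ^+ q).
Proof.
rewrite (sum_phi2 (fun f => f ^+ q)) /conic expr1n mulr1 [(x * y) ^+ q]exprMn.
by rewrite ![_ ^+ 2 ^+ q]exprAC.
Qed.

Lemma hasse_xM k f : D k.+1 (x * f) = x * D k.+1 f + D k f.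
Proof.
rewrite hasseM big_ord_recl big_ord_recl big1 /=.
  by rewrite /bump /= hasse0 hasse_x1 mul1r subn0 subn1 addr0.
by move=> i _; rewrite /bump /= hasse_x ?mul0r.
Qed.

Local Notation "''y_' k" := (D k y) (at level 8, k at level 2, format "''y_' k").

(** * The osculating conic and Monge's equation *)

Section OsculatingConic.

Variable c : nat -> K.
Hypothesis osculates :
  forall i, (i < 5)%N -> \sum_(j < nmonos 2) c j * D i (phi x y 2 j) = 0.

(** The partial derivative of the conic with respect to Y at (x, y). *)
Let c_y : K := c 1%N + 2%:R * y * c 2%N + x * c 4%N.

Lemma osculating_rows :
  [/\ conic c x y = 0,
      c_y * 'y_1 + c 3%N + c 4%N * y + 2%:R * x * c 5%N = 0,
      c_y * 'y_2 + c 2%N * 'y_1 ^+ 2 + c 4%N * 'y_1 + c 5%N = 0,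
      c_y * 'y_3 + (c 4%N + 2%:R * c 2%N * 'y_1) * 'y_2 = 0 &
      c_y * 'y_4 + (c 4%N + 2%:R * c 2%N * 'y_1) * 'y_3 + c 2%N * 'y_2 ^+ 2 = 0].
Proof.
have y2E k : D k (y ^+ 2) = \sum_(i < k.+1) 'y_i * 'y_(k - i) by rewrite expr2 hasseM.
have rows i : (i < 5)%N -> c 0%N * D i 1 + c 1%N * D i y + c 2%N * D i (y ^+ 2) +
  c 3%N * D i x + c 4%N * D i (x * y) + c 5%N * D i (x * x) = 0.
  by move=> i5; rewrite -(sum_phi2 (D i)) osculates.
have := (rows 0%N isT, rows 1%N isT, rows 2%N isT, rows 3%N isT, rows 4%N isT).
have oneS k : D k.+1 1 = 0 by rewrite hasse_one.
have xSS k : D k.+2 x = 0 by rewrite hasse_x.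
rewrite !hasse_xM !oneS !xSS !y2E !big_ord_recl !big_ord0 /bump /=.
rewrite ?(subn0, subSS) !hasse_x1 !hasse0 /conic.
move=> [[[[r0 r1] r2] r3] r4].
rewrite /c_y; split; [rewrite -[RHS]r0 | rewrite -[RHS]r1 | rewrite -[RHS]r2
  | rewrite -[RHS]r3 | rewrite -[RHS]r4]; ring.
Qed.

Definition osculation_defect (X Z : K) : K :=
  - 'y_2 ^+ 4 * X ^+ 2 + 'y_2 ^+ 3 * Z - 'y_2 ^+ 2 * 'y_3 * (X * Z)
  + ('y_3 ^+ 2 - 'y_2 * 'y_4) * Z ^+ 2.

(** After moving the origin to (x, y) and measuring Z from the tangent, the five osculation
    conditions determine all coefficients up to the common factor [c_y]. This is the uniqueness of
    the osculating conic. *)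
Lemma osculating_conic_eval X Z :
  'y_2 ^+ 3 * conic c (x + X) (y + 'y_1 * X + Z) = c_y * osculation_defect X Z.
Proof.
case: osculating_rows; rewrite /conic /osculation_defect.
set e0 := (e in e = 0 -> _) => r0; set e1 := (e in e = 0 -> _) => r1.
set e2 := (e in e = 0 -> _) => r2; set e3 := (e in e = 0 -> _) => r3.
set e4 := (e in e = 0 -> _) => r4.
(* The two sides differ by an explicit combination of the five conditions, found by eliminating the
   coefficients of 1, X, X^2, XZ and Z^2 in turn. *)
have <- : c_y * osculation_defect X Z +
    ('y_2 ^+ 3 * (e0 + X * e1 + X ^+ 2 * e2) + 'y_2 ^+ 2 * X * Z * e3
     + Z ^+ 2 * ('y_2 * e4 - 'y_3 * e3)) =
    'y_2 ^+ 3 * conic c (x + X) (y + 'y_1 * X + Z).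
  by rewrite /e0 /e1 /e2 /e3 /e4 /conic /osculation_defect /c_y; ring.
by rewrite r0 r1 r2 r3 r4 !(mulr0, addr0, subr0).
Qed.

(** Once [c_y] vanishes the conditions become triangular: as y_2 is nonzero, orders 3 and 4 kill the
    coefficients of y^2 and xy, and the lower orders kill the others one by one. *)
Lemma osculating_conic_neq0 :
  'y_2 != 0 -> (exists2 j, (j < 6)%N & c j != 0) -> c_y != 0.
Proof.
move=> y2 [j j6]; apply: contraNneq => cy0.
case: osculating_rows; rewrite cy0 !mul0r !add0r => r0 r1 r2 r3 r4.
have {}r3 : c 4%N + 2%:R * c 2%N * 'y_1 = 0.
  by move/eqP: r3; rewrite mulf_eq0 (negPf y2) orbF => /eqP.
have c2 : c 2%N = 0.
  by move/eqP: r4; rewrite r3 mul0r add0r mulf_eq0 expf_eq0 (negPf y2) orbF => /eqP.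
have c4 : c 4%N = 0 by rewrite -[RHS]r3 c2; ring.
have c5 : c 5%N = 0 by rewrite -[RHS]r2 c2 c4; ring.
have c3 : c 3%N = 0 by rewrite -[RHS]r1 c5 c4; ring.
have c1 : c 1%N = 0 by rewrite -[RHS]cy0 /c_y c2 c4; ring.
have c0 : c 0%N = 0 by rewrite -[RHS]r0 /conic c1 c2 c3 c4 c5; ring.
by case: j j6 => [|[|[|[|[|[|j]]]]]] // _; apply/eqP.
Qed.

End OsculatingConic.

(** In ordinary derivatives, 4320 times this is the classical 9 y''^2 y^(5) - 45 y'' y''' y'''' + 40
    y'''^3. *)
Definition monge : K :=
  'y_2 ^+ 2 * 'y_5 - 3%:R * 'y_2 * 'y_3 * 'y_4 + 2%:R * 'y_3 ^+ 3.

(** The two hypotheses hold for X = x^q - x and Z = y^q - y - y_1 X, because q-th powers are killed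
    by [D 1] and [D 1] of y_1 is 2 y_2. Modulo the defect itself, its derivative is a multiple of
    Monge's expression. *)
Lemma derive_osculation_defect X Z :
  D 1 X = -1 -> D 1 Z = - (2%:R * 'y_2 * X) ->
  'y_2 * D 1 (osculation_defect X Z) =
  10%:R * 'y_3 * osculation_defect X Z - 5%:R * monge * Z ^+ 2.
Proof.
move=> dX dZ; rewrite /osculation_defect /monge.
rewrite !(hasseDD, deriveM, deriveN, deriveX, derive_hasse, dX, dZ) /=.
by ring.
Qed.

(** * The Frobenius condition for a known conic *)

Section FrobeniusConic.

Variables (p q : nat).
Hypotheses (pcharKp : p \in [pchar K]) (p_gt5 : (5 < p)%N) (p_dvd_q : (p %| q)%N).
Hypothesis y2_neq0 : 'y_2 != 0.

Let X : K := x ^+ q - x.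
Let Z : K := y ^+ q - y - 'y_1 * X.

Lemma frob_mx_defect :
  \det (frob_mx D x y q 2 (iota 0 5)) = 0 -> osculation_defect X Z = 0.
Proof.
case/frob_mx_det0P=> c [c_neq0 frob0 osc].
have := osculating_conic_eval osc X Z.
rewrite [x + X]addrC subrK (_ : y + _ + Z = y ^+ q); last by rewrite /Z; ring.
rewrite -sum_phi2_pow frob0 mulr0 => /esym/eqP.
by rewrite mulf_eq0 (negPf (osculating_conic_neq0 osc _ _)) //= => /eqP.
Qed.

(** Differentiating the vanishing defect leaves 5 Z^2 times Monge's expression equal to 0, and 5 is
    invertible. If Z were 0, the defect would reduce to -y_2^4 X^2, forcing x^q = x. *)
Lemma frob_mx_monge :
  x ^+ q != x -> \det (frob_mx D x y q 2 (iota 0 5)) = 0 -> monge = 0.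
Proof.
move=> xq /frob_mx_defect defect0.
have q0 : q%:R = 0 :> K by apply/eqP; rewrite -(dvdn_pcharf pcharKp).
have dX : D 1 X = -1 by rewrite hasseDD deriveN deriveX hasse_x1 q0; ring.
have dZ : D 1 Z = - (2%:R * 'y_2 * X).
  rewrite !hasseDD !deriveN deriveM derive_hasse dX deriveX q0; ring.
have := derive_osculation_defect dX dZ.
rewrite defect0 hasse_zero !mulr0 sub0r => /esym/eqP.
rewrite oppr_eq0 mulf_eq0 expf_eq0 /= mulf_eq0 -(dvdn_pcharf pcharKp).
rewrite gtnNdvd //= => /orP[/eqP//|/eqP Z0].
move: defect0; rewrite /osculation_defect Z0 expr0n !mulr0 !addr0 subr0.
by move/eqP; rewrite mulf_eq0 expf_eq0 oppr_eq0 expf_eq0 /= (negPf y2_neq0) subr_eq0 (negPf xq).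
Qed.

(** Coefficients killed by [D 1] commute with [D i] for i < 5 < p, so applying [D i] to the equation
    at (x, y) shows that this conic osculates. By uniqueness it is the one to be tested at the
    Frobenius image. *)
Lemma frob_mx_conic (c : nat -> K) :
  (forall j, (j < 6)%N -> D 1 (c j) = 0) -> (exists2 j, (j < 6)%N & c j != 0) ->
  conic c x y = 0 ->
  \det (frob_mx D x y q 2 (iota 0 5)) = 0 <-> conic c (x ^+ q) (y ^+ q) = 0.
Proof.
move=> dc c_neq0 cxy.
have osc i : (i < 5)%N -> \sum_(j < nmonos 2) c j * D i (phi x y 2 j) = 0.
  move=> i5; rewrite -[RHS](hasse_zero i) -[0 in RHS]cxy.
  have -> : conic c x y = \sum_(j < nmonos 2) c j * phi x y 2 j.
    by rewrite (sum_phi2 id) /conic mulr1.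
  rewrite hasse_sum; apply: eq_bigr => j _.
  by rewrite (hasse_constM pcharKp) ?dc // (ltn_trans i5).
split=> [det0|cq].
  have := osculating_conic_eval osc X Z.
  rewrite (frob_mx_defect det0) mulr0 [x + X]addrC subrK.
  rewrite (_ : y + _ + Z = y ^+ q); last by rewrite /Z; ring.
  by move/eqP; rewrite mulf_eq0 expf_eq0 /= (negPf y2_neq0) => /eqP.
by apply/frob_mx_det0P; exists c; split; rewrite ?sum_phi2_pow.
Qed.

End FrobeniusConic.

(** * Higher derivatives of y on a Fermat curve *)

Section FermatDerivatives.

Variables (ν μ u v : K).
Hypotheses (dν : D 1 ν = 0) (dμ : D 1 μ = 0).
Hypotheses (xdu : x * D 1 u = ν * u) (xdv : x * D 1 v = - (ν * u)).
Hypothesis xdy : μ * x * v * D 1 y = - (ν * u * y).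

(** Multiplication by z clears the denominator of [D 1 y]. The derivation θ preserves polynomials in
    u and v, since θ u = μνuv and θ v = -μνuv. *)
Let z := μ * x * v.
Let θ f := z * D 1 f.

(** Apply z [D 1] to the hypothesis, using θ y = -νuy and [D 1] z = μv - μνu; the last term of the
    new polynomial compensates for differentiating z^k. *)
Lemma fermat_hasse_step k Q :
  z ^+ k * (k`!%:R * D k y) = y * Q ->
  z ^+ k.+1 * (k.+1`!%:R * D k.+1 y) =
  y * (θ Q - ν * u * Q - k%:R * (μ * v - μ * ν * u) * Q).
Proof.
move=> zkQ; have := congr1 (fun f => z * D 1 f) zkQ.
rewrite !deriveM deriveX derive_nat derive_hasse.
have -> : D 1 z = μ * v - μ * ν * u.
  by rewrite !deriveM hasse_x1 dμ -[μ * ν * u]mulrA -[ν * u]opprK -xdv; ring.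
have -> : z * (D 1 y * Q + y * D 1 Q) = y * (θ Q - ν * u * Q).
  by rewrite mulrDr [z * (D 1 y * Q)]mulrA {1}/z xdy /θ; ring.
move=> dzkQ; rewrite factS natrM mulrBr.
rewrite -[y * (_ - _)]dzkQ.
rewrite (_ : y * (k%:R * _ * Q) = k%:R * (μ * v - μ * ν * u) * (y * Q)); last by ring.
rewrite -zkQ; case: k {zkQ dzkQ} => [|k] /=; rewrite ?exprS; ring.
Qed.

Lemma fermat_hasse :
  [/\ z ^+ 2 * (2%:R * D 2 y) = y * - (ν * u * (μ * (ν - 1) * v + ν * (μ - 1) * u)),
      z ^+ 3 * (6%:R * D 3 y) = y * - (ν * u *
        (μ ^+ 2 * (ν - 1) * (ν - 2%:R) * v ^+ 2
         + 3%:R * ν * μ * (ν - 1) * (μ - 1) * u * v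
         + ν ^+ 2 * (μ - 1) * (2%:R * μ - 1) * u ^+ 2)),
      z ^+ 4 * (24%:R * D 4 y) = y * - (ν * u *
        (μ ^+ 3 * (ν - 1) * (ν - 2%:R) * (ν - 3%:R) * v ^+ 3
         + ν * μ ^+ 2 * (ν - 1) * (μ - 1) * (7%:R * ν - 11%:R) * u * v ^+ 2
         + 6%:R * ν ^+ 2 * μ * (ν - 1) * (μ - 1) * (2%:R * μ - 1) * u ^+ 2 * v
         + ν ^+ 3 * (μ - 1) * (2%:R * μ - 1) * (3%:R * μ - 1) * u ^+ 3)) &
      z ^+ 5 * (120%:R * D 5 y) = y * - (ν * u *
        (μ ^+ 4 * (ν - 1) * (ν - 2%:R) * (ν - 3%:R) * (ν - 4%:R) * v ^+ 4
         + 5%:R * ν * μ ^+ 3 * (ν - 1) * (μ - 1) * (ν - 2%:R) * (3%:R * ν - 5%:R) * u * v ^+ 3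
         + 5%:R * ν ^+ 2 * μ ^+ 2 * (ν - 1) * (μ - 1) * (2%:R * μ - 1) * (5%:R * ν - 7%:R) * u ^+ 2 * v ^+ 2
         + 10%:R * ν ^+ 3 * μ * (ν - 1) * (μ - 1) * (2%:R * μ - 1) * (3%:R * μ - 1) * u ^+ 3 * v
         + ν ^+ 4 * (μ - 1) * (2%:R * μ - 1) * (3%:R * μ - 1) * (4%:R * μ - 1) * u ^+ 4))].
Proof.
have θD f g : θ (f + g) = θ f + θ g by rewrite /θ hasseDD mulrDr.
have θN f : θ (- f) = - θ f by rewrite /θ deriveN mulrN.
have θM f g : θ (f * g) = θ f * g + f * θ g by rewrite /θ deriveM; ring.
have θX f i : θ (f ^+ i) = i%:R * f ^+ i.-1 * θ f by rewrite /θ deriveX; ring.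
have θ1 : θ 1 = 0 by rewrite /θ hasse_one // mulr0.
have θn i : θ i%:R = 0 by rewrite /θ derive_nat mulr0.
have θν : θ ν = 0 by rewrite /θ dν mulr0.
have θμ : θ μ = 0 by rewrite /θ dμ mulr0.
have θu : θ u = μ * ν * u * v by transitivity (μ * v * (x * D 1 u)); [rewrite /θ /z | rewrite xdu]; ring.
have θv : θ v = - (μ * ν * u * v) by transitivity (μ * v * (x * D 1 v)); [rewrite /θ /z | rewrite xdv]; ring.
pose θE := (θD, θN, θM, θX, θ1, θn, θν, θμ, θu, θv).
have z1 : z ^+ 1 * (1`!%:R * D 1 y) = y * - (ν * u).
  by rewrite expr1 mul1r [LHS]xdy; ring.
have z2 : z ^+ 2 * (2`!%:R * D 2 y) = y * - (ν * u * (μ * (ν - 1) * v + ν * (μ - 1) * u)).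
  by rewrite (fermat_hasse_step z1) !θE /=; ring.
have z3 : z ^+ 3 * (3`!%:R * D 3 y) = y * - (ν * u *
        (μ ^+ 2 * (ν - 1) * (ν - 2%:R) * v ^+ 2
         + 3%:R * ν * μ * (ν - 1) * (μ - 1) * u * v
         + ν ^+ 2 * (μ - 1) * (2%:R * μ - 1) * u ^+ 2)).
  by rewrite (fermat_hasse_step z2) !θE /=; ring.
have z4 : z ^+ 4 * (4`!%:R * D 4 y) = y * - (ν * u *
        (μ ^+ 3 * (ν - 1) * (ν - 2%:R) * (ν - 3%:R) * v ^+ 3
         + ν * μ ^+ 2 * (ν - 1) * (μ - 1) * (7%:R * ν - 11%:R) * u * v ^+ 2
         + 6%:R * ν ^+ 2 * μ * (ν - 1) * (μ - 1) * (2%:R * μ - 1) * u ^+ 2 * v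
         + ν ^+ 3 * (μ - 1) * (2%:R * μ - 1) * (3%:R * μ - 1) * u ^+ 3)).
  by rewrite (fermat_hasse_step z3) !θE /=; ring.
by split=> //; rewrite (fermat_hasse_step z4) !θE /=; ring.
Qed.

(** The factor 4320 turns Monge's expression into one in k! [D k y], and every monomial of it has
    total order 9, hence z^9. Substituting [fermat_hasse] leaves a form of degree 6 in u and v. *)
Lemma fermat_monge :
  4320%:R * z ^+ 9 * monge = y ^+ 3 * ν ^+ 3 * u ^+ 3 *
   (- (2%:R * μ ^+ 6 * (ν - 1) ^+ 3 * (ν + 1) * (ν - 2%:R) * (2%:R * ν - 1)) * v ^+ 6
    - 9%:R * ν * μ ^+ 5 * (ν - 1) ^+ 2 * (μ - 1) * (ν + 1) * (ν - 2%:R) * (2%:R * ν - 1) * u * v ^+ 5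
    + 3%:R * ν ^+ 2 * μ ^+ 4 * (ν - 1) * (μ - 1) * (ν + 1) * (2%:R * ν - 1) * (13%:R * μ - 4%:R * ν * μ - ν - 8%:R)
      * u ^+ 2 * v ^+ 4
    + 45%:R * ν ^+ 3 * μ ^+ 3 * (ν - 1) * (μ - 1) * (ν - μ) * (1 - ν * μ - ν - μ) * u ^+ 3 * v ^+ 3
    + 3%:R * ν ^+ 4 * μ ^+ 2 * (ν - 1) * (μ - 1) * (μ + 1) * (2%:R * μ - 1) * (4%:R * ν * μ - 13%:R * ν + μ + 8%:R)
      * u ^+ 4 * v ^+ 2
    + 9%:R * ν ^+ 5 * μ * (ν - 1) * (μ - 1) ^+ 2 * (μ + 1) * (μ - 2%:R) * (2%:R * μ - 1) * u ^+ 5 * v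
    + 2%:R * ν ^+ 6 * (μ - 1) ^+ 3 * (μ + 1) * (μ - 2%:R) * (2%:R * μ - 1) * u ^+ 6).
Proof.
case: fermat_hasse => z2 z3 z4 z5.
have -> : 4320%:R * z ^+ 9 * monge =
  9%:R * (z ^+ 2 * (2%:R * D 2 y)) ^+ 2 * (z ^+ 5 * (120%:R * D 5 y))
  - 45%:R * (z ^+ 2 * (2%:R * D 2 y)) * (z ^+ 3 * (6%:R * D 3 y)) * (z ^+ 4 * (24%:R * D 4 y))
  + 40%:R * (z ^+ 3 * (6%:R * D 3 y)) ^+ 3.
  by rewrite /monge; ring.
by rewrite z2 z3 z4 z5; ring.
Qed.

End FermatDerivatives.

End HasseDerivation.

(** * Auxiliary algebra and divisibility *)

(** The values at 0 and 1 give the two extreme coefficients; dividing by X(1 - X) and repeating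
    peels the form down to its middle term. *)
Lemma sextic_form_coefs (R : idomainType) (c0 c1 c2 c3 c4 c5 c6 : R) :
  c0 *: (1 - 'X) ^+ 6 + c1 *: ('X * (1 - 'X) ^+ 5) + c2 *: ('X ^+ 2 * (1 - 'X) ^+ 4)
  + c3 *: ('X ^+ 3 * (1 - 'X) ^+ 3) + c4 *: ('X ^+ 4 * (1 - 'X) ^+ 2)
  + c5 *: ('X ^+ 5 * (1 - 'X)) + c6 *: 'X ^+ 6 = 0 :> {poly R} ->
  [/\ c0 = 0, c3 = 0 & c6 = 0].
Proof.
have X_neq0 : 'X != 0 :> {poly R} by rewrite polyX_eq0.
have X1_neq0 : 1 - 'X != 0 :> {poly R}.
  by rewrite -oppr_eq0 opprB -[1]polyC1 polyXsubC_eq0.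
pose P2 := c2 *: (1 - 'X) ^+ 2 + c3 *: ('X * (1 - 'X)) + c4 *: 'X ^+ 2 : {poly R}.
pose P1 := c1 *: (1 - 'X) ^+ 4 + 'X * (1 - 'X) * P2 + c5 *: 'X ^+ 4 : {poly R}.
pose P0 := c0 *: (1 - 'X) ^+ 6 + 'X * (1 - 'X) * P1 + c6 *: 'X ^+ 6 : {poly R}.
have eval t P : P = 0 -> P.[t] = 0 :> R by move->; rewrite horner0.
move=> P0_eq0.
have {}P0_eq0 : P0 = 0 by rewrite -[RHS]P0_eq0 /P0 /P1 /P2 -!mul_polyC; ring.
have c0_eq0 : c0 = 0.
  by have := eval 0 _ P0_eq0; rewrite /P0 !hornerE /= => e; rewrite -[RHS]e; ring.
have c6_eq0 : c6 = 0.
  by have := eval 1 _ P0_eq0; rewrite /P0 !hornerE /= => e; rewrite -[RHS]e; ring.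
have P1_eq0 : P1 = 0.
  apply: (mulfI (mulf_neq0 X_neq0 X1_neq0)).
  by rewrite mulr0 -[RHS]P0_eq0 /P0 c0_eq0 c6_eq0 !scale0r add0r addr0.
have c1_eq0 : c1 = 0.
  by have := eval 0 _ P1_eq0; rewrite /P1 !hornerE /= => e; rewrite -[RHS]e; ring.
have c5_eq0 : c5 = 0.
  by have := eval 1 _ P1_eq0; rewrite /P1 !hornerE /= => e; rewrite -[RHS]e; ring.
have P2_eq0 : P2 = 0.
  apply: (mulfI (mulf_neq0 X_neq0 X1_neq0)).
  by rewrite mulr0 -[RHS]P1_eq0 /P1 c1_eq0 c5_eq0 !scale0r add0r addr0.
have c2_eq0 : c2 = 0.
  by have := eval 0 _ P2_eq0; rewrite /P2 !hornerE /= => e; rewrite -[RHS]e; ring.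
have c4_eq0 : c4 = 0.
  by have := eval 1 _ P2_eq0; rewrite /P2 !hornerE /= => e; rewrite -[RHS]e; ring.
split=> //; apply/eqP; move: P2_eq0.
rewrite /P2 c2_eq0 c4_eq0 !scale0r add0r addr0 => /eqP.
by rewrite scale_poly_eq0 mulf_eq0 (negPf X_neq0) (negPf X1_neq0) !orbF.
Qed.

(** With e the remainder of h modulo s, p^h - 1 is congruent to p^e - 1 modulo p^s - 1. Since c < p
    and e < s, the number c(p^e - 1) is smaller than p^s - 1, so divisibility forces e = 0. *)
Lemma expn_sub1_dvd (p s h c : nat) :
  (0 < c < p)%N -> (0 < s)%N -> (p ^ s - 1 %| c * (p ^ h - 1))%N -> (s %| h)%N.
Proof.
case/andP=> c0 cp s0; have p0 : (0 < p)%N by exact: leq_trans cp.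
have pk k : (0 < p ^ k)%N by rewrite expn_gt0 p0.
rewrite {1}(divn_eq h s).
set e := (h %% s)%N; set d := (h %/ s)%N => dvd.
have ds : (p ^ s - 1 %| p ^ (s * d) - 1)%N.
  by rewrite expnM -{2}(exp1n d) subn_exp dvdn_mulr.
have pe_small : (c * (p ^ e - 1) < p ^ s - 1)%N.
  have ps : (p * p ^ e <= p ^ s)%N.
    by rewrite -expnS leq_exp2l ?ltn_mod // (leq_trans _ cp).
  have cpe : (c * p ^ e + p ^ e <= p * p ^ e)%N by rewrite -mulSnr leq_mul2r cp orbT.
  have := leq_trans cpe ps; have := leq_pmulr c (pk e); have := pk e.
  by rewrite mulnBr muln1; move: (c * p ^ e)%N (p ^ e)%N (p ^ s)%N => A B C; clear -c0; lia.
have : (p ^ s - 1 %| c * (p ^ e - 1))%N.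
  have E : (p ^ (d * s + e) - 1 = p ^ e * (p ^ (s * d) - 1) + (p ^ e - 1))%N.
    rewrite expnD [(d * s)%N]mulnC mulnC mulnBr muln1.
    by rewrite addnBA // subnK // leq_pmulr.
  move: dvd; rewrite E mulnDr dvdn_addr //.
  by rewrite dvdn_mull // dvdn_mull.
move=> dvd'; rewrite -[(s %| h)%N]/(e == 0)%N.
have : (c * (p ^ e - 1) == 0)%N.
  by rewrite -leqn0 leqNgt; apply/negP => /dvdn_leq /(_ dvd'); rewrite leqNgt pe_small.
rewrite muln_eq0 gtn_eqF //= subn_eq0; case: e {dvd dvd' pe_small} => // e.
by rewrite leqNgt (leq_trans _ (ltn_expl e.+1 (leq_trans _ cp))).
Qed.

Lemma conic_residue_root (R : fieldType) (t : R) :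
  (t - 1) ^+ 3 * (t + 1) * (t - 2%:R) * (2%:R * t - 1) = 0 ->
  [\/ t = 1, t = -1, t = 2%:R | 2%:R * t = 1].
Proof.
move/eqP; rewrite mulf_eq0 => /orP[|]; last by rewrite subr_eq0 => /eqP; constructor 4.
rewrite mulf_eq0 => /orP[|]; last by rewrite subr_eq0 => /eqP; constructor 3.
rewrite mulf_eq0 => /orP[|]; last by rewrite addr_eq0 => /eqP; constructor 2.
by rewrite expf_eq0 subr_eq0 => /eqP; constructor 1.
Qed.

(** Each of ν and μ is 1, -1, 2 or 1/2. If neither is 1, the mixed equation says ν = μ or (1 + ν)(1
    + μ) = 2. For distinct values the latter would give 2 = 0, or 9/2 = 2 and so 5 = 0. *)
Lemma conic_residues (R : fieldType) (ν μ : R) :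
  2%:R != 0 :> R -> 5%:R != 0 :> R -> ~ (ν = 1 /\ μ = 1) ->
  (ν - 1) ^+ 3 * (ν + 1) * (ν - 2%:R) * (2%:R * ν - 1) = 0 ->
  (ν - 1) * (μ - 1) * (ν - μ) * (1 - ν * μ - ν - μ) = 0 ->
  (μ - 1) ^+ 3 * (μ + 1) * (μ - 2%:R) * (2%:R * μ - 1) = 0 ->
  [\/ ν = 1 /\ [\/ μ = -1, μ = 2%:R | 2%:R * μ = 1],
      μ = 1 /\ [\/ ν = -1, ν = 2%:R | 2%:R * ν = 1],
      ν = -1 /\ μ = -1 |
      ν = 2%:R /\ μ = 2%:R \/ 2%:R * ν = 1 /\ 2%:R * μ = 1].
Proof.
move=> nz2 nz5 not11 /conic_residue_root ν_cases mixed /conic_residue_root μ_cases.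
have [ν1|/eqP ν1] := eqVneq ν 1.
  constructor 1; split=> //; case: μ_cases => [μ1|||]; [by case: not11 | by constructor..].
have [μ1|/eqP μ1] := eqVneq μ 1.
  by constructor 2; split=> //; case: ν_cases => // ?; constructor.
have {mixed} mixed : (ν - μ) * (1 - ν * μ - ν - μ) = 0.
  apply: (@mulfI _ ((ν - 1) * (μ - 1))); last by rewrite mulr0 mulrA.
  by rewrite mulf_neq0 // subr_eq0; apply/eqP.
have [e|νμ] := eqVneq ν μ.
  rewrite e in ν1 ν_cases *; case: ν_cases => // eμ.
  - by constructor 3.
  - by constructor 4; left.
  - by constructor 4; right.
move/eqP: mixed; rewrite mulf_eq0 subr_eq0 (negPf νμ) /= => /eqP mixed.
have two : (1 + ν) * (1 + μ) = 2%:R by rewrite -[RHS]subr0 -[in RHS]mixed; ring.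
have neg1 : 1 + -1 = 0 :> R by rewrite subrr.
have not5 : 5%:R = 0 :> R -> False by move/eqP; apply/negP.
exfalso; case: ν_cases => // eν.
- by move/eqP: two; rewrite eν neg1 mul0r eq_sym (negPf nz2).
- case: μ_cases => // eμ.
  + by move/eqP: two; rewrite eμ neg1 mulr0 eq_sym (negPf nz2).
  + by rewrite eν eμ eqxx in νμ.
  + apply: not5; transitivity (3%:R * (2%:R + 2%:R * μ) - 2%:R * 2%:R).
      by rewrite eμ; ring.
    by transitivity (2%:R * ((1 + ν) * (1 + μ)) - 2%:R * 2%:R); [rewrite eν | rewrite two]; ring.
- case: μ_cases => // eμ.
  + by move/eqP: two; rewrite eμ neg1 mulr0 eq_sym (negPf nz2).
  + apply: not5; transitivity (3%:R * (2%:R + 2%:R * ν) - 2%:R * 2%:R).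
      by rewrite eν; ring.
    by transitivity (2%:R * ((1 + ν) * (1 + μ)) - 2%:R * 2%:R); [rewrite eμ | rewrite two]; ring.
  + by move/eqP: νμ; apply; apply: (mulfI nz2); rewrite eν eμ.
Qed.

(** * The curve and its function field *)

Section FermatCurve.

Variables (p h q n m : nat) (F : finFieldType) (a b : F).
Variables (K : fieldType) (emb : {rmorphism F -> K}) (x y : K) (D : nat -> K -> K).
Hypotheses (p_prime : prime p) (p_gt5 : (5 < p)%N).
Hypotheses (qE : q = (p ^ h)%N) (cardF : #|F| = q).
Hypotheses (a_neq0 : a != 0) (b_neq0 : b != 0).
Hypotheses (n_gt2 : (2 < n)%N) (m_gt2 : (2 < m)%N).
Hypothesis p_ndvd : ~~ (p %| m * n)%N.
Hypothesis x_transc : forall P : {poly F}, P != 0 -> (map_poly emb P).[x] != 0.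
Hypothesis curve : emb a * x ^+ n + emb b * y ^+ m = 1.
Hypothesis hasseD : hasse_derivation emb x D.

Let u := emb a * x ^+ n.
Let v := emb b * y ^+ m.

Lemma h_gt0 : (0 < h)%N.
Proof.
rewrite lt0n; apply: contraTneq isT => h0.
have := max_card (pred2 (0 : F) 1).
by rewrite card2 eq_sym oner_eq0 cardF qE h0.
Qed.

Lemma q_gt1 : (1 < q)%N.
Proof. by rewrite qE -[X in (X < _)%N](exp1n h) ltn_exp2r ?h_gt0 // prime_gt1. Qed.

Lemma p_dvd_q : (p %| q)%N.
Proof. by rewrite qE dvdn_exp // h_gt0. Qed.

Lemma pcharF : p \in [pchar F].
Proof. by apply: (@card_finPcharP _ _ h) p_prime; rewrite cardF qE. Qed.

Lemma pcharK : p \in [pchar K].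
Proof. exact: rmorph_pchar emb _ pcharF. Qed.

Lemma p_ndvd_n : ~~ (p %| n)%N.
Proof. by apply: contra p_ndvd; apply: dvdn_mull. Qed.

Lemma p_ndvd_m : ~~ (p %| m)%N.
Proof. by apply: contra p_ndvd; apply: dvdn_mulr. Qed.

Let n_gt0 : (0 < n)%N. Proof. exact: leq_trans n_gt2. Qed.
Let m_gt0 : (0 < m)%N. Proof. exact: leq_trans m_gt2. Qed.

Lemma natF_eq0 k : (k%:R == 0 :> F) = (p %| k)%N.
Proof. by rewrite (dvdn_pcharf pcharF). Qed.

Lemma natK_eq0 k : (k%:R == 0 :> K) = (p %| k)%N.
Proof. by rewrite (dvdn_pcharf pcharK). Qed.

Let ev (t : K) (P : {poly F}) : K := (map_poly emb P).[t].

Lemma evD t P Q : ev t (P + Q) = ev t P + ev t Q.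
Proof. by rewrite /ev rmorphD hornerD. Qed.

Lemma evN t P : ev t (- P) = - ev t P.
Proof. by rewrite /ev rmorphN hornerN. Qed.

Lemma evM t P Q : ev t (P * Q) = ev t P * ev t Q.
Proof. by rewrite /ev rmorphM hornerM. Qed.

Lemma evXn t P k : ev t (P ^+ k) = ev t P ^+ k.
Proof. by rewrite /ev rmorphXn horner_exp. Qed.

Lemma evZ t c P : ev t (c *: P) = emb c * ev t P.
Proof. by rewrite /ev map_polyZ hornerZ. Qed.

Lemma evX t : ev t 'X = t.
Proof. by rewrite /ev map_polyX hornerX. Qed.

Lemma ev1 t : ev t 1 = 1.
Proof. by rewrite /ev rmorph1 hornerC. Qed.

Let evE := (evD, evN, evM, evXn, evZ, evX, ev1).

Lemma evx_eq0 P : ev x P = 0 -> P = 0.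
Proof. by move/eqP; apply: contraTeq; apply: x_transc. Qed.

Lemma x_neq0 : x != 0.
Proof. by rewrite -(evX x) x_transc // polyX_eq0. Qed.

Lemma emb_eq0 c : (emb c == 0) = (c == 0).
Proof. exact: fmorph_eq0. Qed.

Lemma u_neq0 : u != 0.
Proof. by rewrite mulf_neq0 ?emb_eq0 // expf_neq0 ?x_neq0. Qed.

Lemma vE : v = 1 - u.
Proof. by rewrite -curve -/u -/v addrAC subrr add0r. Qed.

(** Composing with a X^n transfers transcendence from x to u. *)
Lemma evu_eq0 P : ev u P = 0 -> P = 0.
Proof.
have size_ax : (1 < size (a *: 'X^n))%N by rewrite size_scale // size_polyXn.
move=> Pu; apply/eqP; rewrite -(comp_poly_eq0 _ size_ax); apply/eqP/evx_eq0.
by rewrite /ev map_comp_poly horner_comp -/(ev x _) !evE.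
Qed.

Lemma v_neq0 : v != 0.
Proof.
apply/negP => /eqP v0; have : (1 - 'X : {poly F}) = 0.
  by apply: evu_eq0; rewrite !evE -vE.
by move/eqP; rewrite -oppr_eq0 opprB -[1]polyC1 polyXsubC_eq0.
Qed.

Lemma y_neq0 : y != 0.
Proof. by apply: contraNneq v_neq0 => y0; rewrite /v y0 expr0n gtn_eqF // mulr0. Qed.

Lemma v_exp_neq1 k : (0 < k)%N -> v ^+ k != 1.
Proof.
move=> k0; apply/negP => /eqP vk.
have : ((1 - 'X) ^+ k - 1 : {poly F}) = 0.
  by apply: evu_eq0; rewrite !evE -vE vk subrr.
move/(congr1 (fun P => P.[1])); rewrite !hornerE /= subrr expr0n gtn_eqF // sub0r.
by move/eqP; rewrite oppr_eq0 oner_eq0.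
Qed.

Lemma emb_expf_card c : c != 0 -> emb c ^+ (q - 1) = 1.
Proof.
move=> c0; rewrite -rmorphXn; have : c ^+ q = c by rewrite -cardF expf_card.
rewrite -[q in LHS](subnK (ltnW q_gt1)) addn1 exprS -[RHS]mulr1 => /(mulfI c0) ->.
exact: rmorph1.
Qed.

(** Nonzero constants are (q-1)-st roots of unity, so a constant power of y would make some positive
    power of v equal to 1. *)
Lemma y_exp_nconst k c : (0 < k)%N -> y ^+ k != emb c.
Proof.
move=> k0; apply/negP => /eqP yk.
have c0 : c != 0 by rewrite -emb_eq0 -yk expf_neq0 ?y_neq0.
have /negP[] : v ^+ (k * (q - 1)) != 1.
  by rewrite v_exp_neq1 // muln_gt0 k0 subn_gt0 q_gt1.
have -> : v ^+ (k * (q - 1)) = (emb b ^+ (q - 1)) ^+ k * ((y ^+ k) ^+ (q - 1)) ^+ m.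
  by rewrite /v exprMn -!exprM; congr (_ ^+ _ * _ ^+ _); [exact: mulnC | by rewrite mulnC mulnA].
by rewrite yk !emb_expf_card // !expr1n mulr1.
Qed.

Lemma x_derive_monomial N (α : F) : x * D 1 (emb α * x ^+ N) = N%:R * (emb α * x ^+ N).
Proof.
rewrite (deriveM hasseD) (hasse_emb hasseD) // (deriveX hasseD) (hasse_x1 hasseD).
by case: N => [|N] /=; rewrite ?exprS; ring.
Qed.

Lemma y_derive_monomial M (β : F) :
  y * (x * D 1 (emb β * y ^+ M)) = M%:R * (emb β * y ^+ M) * (x * D 1 y).
Proof.
rewrite (deriveM hasseD) (hasse_emb hasseD) // (deriveX hasseD).
by case: M => [|M] /=; rewrite ?exprS; ring.
Qed.

Lemma relation_derivative N M (α β : F) :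
  let U := emb α * x ^+ N in let V := emb β * y ^+ M in U + V = 1 ->
  x * D 1 V = - (N%:R * U) /\ M%:R * V * (x * D 1 y) = - (N%:R * U * y).
Proof.
move=> U V UV; have dV : x * D 1 V = - (N%:R * U).
  rewrite -x_derive_monomial -/U -mulrN -(deriveN hasseD).
  rewrite (_ : V = 1 + - U); last by rewrite -UV addrAC subrr add0r.
  by rewrite (hasseDD hasseD) (hasse_one hasseD) // add0r.
by split=> //; rewrite -y_derive_monomial -/V dV mulrN mulrC.
Qed.

Let ν : F := n%:R.
Let μ : F := m%:R.

(** Since v = 1 - u and u is transcendental, the vanishing sextic can be compared coefficient by
    coefficient; the coefficients of v^6, u^3 v^3 and u^6 feed [conic_residues]. *)
Lemma fermat_monge_eq0 :
  D 2 y != 0 -> monge y D = 0 ->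
  [\/ ν = 1 /\ [\/ μ = -1, μ = 2%:R | 2%:R * μ = 1],
      μ = 1 /\ [\/ ν = -1, ν = 2%:R | 2%:R * ν = 1],
      ν = -1 /\ μ = -1 |
      ν = 2%:R /\ μ = 2%:R \/ 2%:R * ν = 1 /\ 2%:R * μ = 1].
Proof.
move=> y2 mg0.
have [xdv xdy] := relation_derivative curve; rewrite -/u -/v in xdv xdy.
have xdu : x * D 1 u = n%:R * u by rewrite /u x_derive_monomial.
have dn k : D 1 k%:R = 0 by rewrite (derive_nat hasseD).
have {}xdy : m%:R * x * v * D 1 y = - (n%:R * u * y) by rewrite -xdy; ring.
have [z2 _ _ _] := fermat_hasse hasseD (dn n) (dn m) xdu xdv xdy.
have /eqP := fermat_monge hasseD (dn n) (dn m) xdu xdv xdy.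
have nz_lead : y ^+ 3 * n%:R ^+ 3 * u ^+ 3 != 0.
  have nK : n%:R != 0 :> K by rewrite natK_eq0 p_ndvd_n.
  apply: mulf_neq0; last exact/expf_neq0/u_neq0.
  by apply: mulf_neq0; [exact/expf_neq0/y_neq0 | exact: expf_neq0].
rewrite mg0 mulr0 eq_sym mulf_eq0 (negPf nz_lead) /= => /eqP form_eq0.
(* The coefficients come from F because n and m do, so the form is the value at u of a polynomial
   over F. *)
pose c0 := - (2%:R * μ ^+ 6 * (ν - 1) ^+ 3 * (ν + 1) * (ν - 2%:R) * (2%:R * ν - 1)).
pose c1 := - (9%:R * ν * μ ^+ 5 * (ν - 1) ^+ 2 * (μ - 1) * (ν + 1) * (ν - 2%:R) * (2%:R * ν - 1)).
pose c2 := 3%:R * ν ^+ 2 * μ ^+ 4 * (ν - 1) * (μ - 1) * (ν + 1) * (2%:R * ν - 1)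
  * (13%:R * μ - 4%:R * ν * μ - ν - 8%:R).
pose c3 := 45%:R * ν ^+ 3 * μ ^+ 3 * (ν - 1) * (μ - 1) * (ν - μ) * (1 - ν * μ - ν - μ).
pose c4 := 3%:R * ν ^+ 4 * μ ^+ 2 * (ν - 1) * (μ - 1) * (μ + 1) * (2%:R * μ - 1)
  * (4%:R * ν * μ - 13%:R * ν + μ + 8%:R).
pose c5 := 9%:R * ν ^+ 5 * μ * (ν - 1) * (μ - 1) ^+ 2 * (μ + 1) * (μ - 2%:R) * (2%:R * μ - 1).
pose c6 := 2%:R * ν ^+ 6 * (μ - 1) ^+ 3 * (μ + 1) * (μ - 2%:R) * (2%:R * μ - 1).
have [|] := @sextic_form_coefs _ c0 c1 c2 c3 c4 c5 c6.
  apply: evu_eq0; rewrite !evE -vE -[RHS]form_eq0 /c0 /c1 /c2 /c3 /c4 /c5 /c6.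
  rewrite !(rmorphM, rmorphB, rmorphD, rmorphN, rmorphXn, rmorph1, rmorph_nat) /=.
  ring.
have nz k : (0 < k < p)%N -> k%:R != 0 :> F.
  by case/andP=> k0 kp; rewrite natF_eq0 gtnNdvd.
have p_gt k : (k <= 5)%N -> (k < p)%N by move/leq_ltn_trans; apply.
have [nz2 nz3 nz5] : [/\ 2%:R != 0 :> F, 3%:R != 0 :> F & 5%:R != 0 :> F].
  by split; apply: nz; rewrite p_gt.
have nz45 : 45%:R != 0 :> F by rewrite -[45%N]/(3 * 3 * 5)%N !natrM !mulf_neq0.
have [ν_neq0 μ_neq0] : ν != 0 /\ μ != 0 by rewrite !natF_eq0 p_ndvd_n p_ndvd_m.
(* If both residues were 1, the formula for z^2 [D 2 y] would vanish, against y_2 being nonzero. *)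
have not11 : ~ (ν = 1 /\ μ = 1).
  case=> ν1 μ1; have K1 k : k%:R = 1 :> F -> k%:R = 1 :> K.
    by move=> k1; rewrite -(rmorph_nat emb) k1 rmorph1.
  have /negP[] : (m%:R * x * v) ^+ 2 * (2%:R * D 2 y) != 0.
    rewrite (K1 _ μ1) mul1r; apply: mulf_neq0.
      by apply/expf_neq0/mulf_neq0; [exact: x_neq0 | exact: v_neq0].
    by apply: mulf_neq0 => //; rewrite natK_eq0 gtnNdvd ?p_gt.
  by rewrite z2 (K1 _ ν1) (K1 _ μ1) subrr; apply/eqP; ring.
move=> c0_eq0 c3_eq0 c6_eq0; apply: (conic_residues nz2 nz5 not11).
- apply: (mulfI (mulf_neq0 nz2 (expf_neq0 6 μ_neq0))).
  by rewrite mulr0 -[RHS]oppr0 -[in RHS]c0_eq0 /c0; ring.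
- apply: (mulfI (mulf_neq0 nz45 (mulf_neq0 (expf_neq0 3 ν_neq0) (expf_neq0 3 μ_neq0)))).
  by rewrite mulr0 -[RHS]c3_eq0 /c3; ring.
- apply: (mulfI (mulf_neq0 nz2 (expf_neq0 6 ν_neq0))).
  by rewrite mulr0 -[RHS]c6_eq0 /c6; ring.
Qed.

(** * Fermat relations satisfied by x and y *)

Lemma frobeniusD s (f g : K) : (f + g) ^+ (p ^ s) = f ^+ (p ^ s) + g ^+ (p ^ s).
Proof. by rewrite exprDn_pchar // pnatX pnatE // pcharK. Qed.

Lemma pth_root (c : F) : exists c', c' ^+ p = c.
Proof.
exists (c ^+ (p ^ h.-1)); rewrite -exprM -expnSr prednK ?h_gt0 //.
by rewrite -qE -cardF expf_card.
Qed.

(* Differentiating both relations yields a polynomial identity in x unless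
   p divides N and M, in which case the relation is a p-th power. *)
Lemma fermat_power N M (α β : F) :
  (0 < N)%N -> (0 < M)%N -> α != 0 -> β != 0 ->
  emb α * x ^+ N + emb β * y ^+ M = 1 ->
  exists s, [/\ N = (p ^ s * n)%N, M = (p ^ s * m)%N,
                α = a ^+ (p ^ s) & β = b ^+ (p ^ s)].
Proof.
elim/ltn_ind: N M α β => N IHN M α β N_gt0 M_gt0 α_neq0 β_neq0 rel.
pose U := emb α * x ^+ N; pose V := emb β * y ^+ M.
have V_neq0 : V != 0 by rewrite mulf_neq0 ?emb_eq0 // expf_neq0 ?y_neq0.
have [_ xdy] := relation_derivative curve; rewrite -/u -/v in xdy.
have [_ xdy'] := relation_derivative rel; rewrite -/U -/V in xdy'.
have cross : N%:R * U * (m%:R * v) = M%:R * V * (n%:R * u).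
  apply: (mulIf y_neq0).
  have -> : N%:R * U * (m%:R * v) * y = - - (N%:R * U * y) * (m%:R * v) by ring.
  rewrite -xdy'.
  have -> : - (M%:R * V * (x * D 1 y)) * (m%:R * v) = - (M%:R * V) * (m%:R * v * (x * D 1 y)) by ring.
  by rewrite xdy; ring.
have [pN|pN] := boolP (p %| N)%N.
  have pM : (p %| M)%N.
    move: cross; rewrite (eqP (_ : N%:R == 0 :> K)) ?natK_eq0 // !mul0r => /esym/eqP.
    have nu_neq0 : n%:R * u != 0 by rewrite mulf_neq0 ?u_neq0 // natK_eq0 p_ndvd_n.
    by rewrite mulf_eq0 (negPf nu_neq0) orbF mulf_eq0 (negPf V_neq0) orbF natK_eq0.
  case/dvdnP: pN => N' NE; case/dvdnP: pM => M' ME.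
  have [α' αE] := pth_root α; have [β' βE] := pth_root β.
  have rel' : emb α' * x ^+ N' + emb β' * y ^+ M' = 1.
    set f := emb α' * _; set g := emb β' * _.
    apply: (fmorph_inj (pFrobenius_aut pcharK)).
    rewrite /= !pFrobenius_autE expr1n; have := frobeniusD 1 f g; rewrite expn1 => ->.
    by rewrite !exprMn -!rmorphXn αE βE -!exprM -NE -ME.
  have [|||||s [N'E M'E α'E β'E]] := IHN N' _ M' α' β' _ _ _ _ rel'.
  - by rewrite NE ltn_Pmulr ?prime_gt1 //; case: (N') NE N_gt0 => //; rewrite mul0n => ->.
  - by case: (N') NE N_gt0 => //; rewrite mul0n => ->.
  - by case: (M') ME M_gt0 => //; rewrite mul0n => ->.
  - by apply: contraNneq α_neq0 => α'0; rewrite -αE α'0 expr0n gtn_eqF ?prime_gt0.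
  - by apply: contraNneq β_neq0 => β'0; rewrite -βE β'0 expr0n gtn_eqF ?prime_gt0.
  exists s.+1; rewrite NE ME -αE -βE N'E M'E α'E β'E expnSr -!exprM.
  by split=> //; rewrite -!mulnA [(p * _)%N]mulnC.
(* This is [cross] with V = 1 - U and v = 1 - u substituted; the products Uu collect in degree N +
   n. The coefficients of degree N, N + n and n then give N = n, M = m modulo p, and α = a. *)
pose P : {poly F} := (N%:R * m%:R * α) *: 'X^N - (M%:R * n%:R * a) *: 'X^n
  + ((M%:R * n%:R - N%:R * m%:R) * (α * a)) *: 'X^(N + n).
have P0 : P = 0.
  apply: evx_eq0; rewrite /P !evE !(rmorphM, rmorphB, rmorph_nat) exprD.
  transitivity (N%:R * U * (m%:R * (1 - u)) - M%:R * (1 - U) * (n%:R * u)).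
    by rewrite /U /u; ring.
  rewrite -vE (_ : 1 - U = V); first by rewrite cross subrr.
  by rewrite -rel -/U -/V; ring.
have coefP k : N%:R * m%:R * α * (k == N)%:R - M%:R * n%:R * a * (k == n)%:R
    + (M%:R * n%:R - N%:R * m%:R) * (α * a) * (k == (N + n)%N)%:R = 0.
  by rewrite -[RHS](coef0 F k) -P0 /P !coefE.
have Nm_neq0 : N%:R * m%:R != 0 :> F by rewrite mulf_neq0 // natF_eq0 // p_ndvd_m.
have expE : [/\ (N == (N + n)%N) = false, (n == (N + n)%N) = false,
                ((N + n)%N == N) = false & ((N + n)%N == n) = false].
  by clear -n_gt0 N_gt0; split; apply/eqP; lia.
have NE : N = n.
  apply/eqP; have := coefP N; rewrite eqxx; case: expE => -> _ _ _.
  case: eqP => // _; rewrite !mulr0 mulr1 subr0 addr0 => /eqP.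
  by rewrite mulf_eq0 (negPf Nm_neq0) (negPf α_neq0).
have n_neq0 : n%:R != 0 :> F by rewrite natF_eq0 p_ndvd_n.
have Mm : M%:R = m%:R :> F.
  have := coefP (N + n)%N; rewrite eqxx; case: expE => _ _ -> ->.
  rewrite NE !mulr0 subrr add0r mulr1 => /eqP.
  rewrite [n%:R * _]mulrC -mulrBl mulf_eq0 [_ * a == 0]mulf_eq0 (negPf α_neq0) (negPf a_neq0).
  by rewrite !orbF mulf_eq0 (negPf n_neq0) orbF subr_eq0 => /eqP.
have αE : α = a.
  have := coefP n; rewrite eqxx; case: expE => _ -> _ _.
  rewrite NE eqxx Mm !mulr0 addr0 !mulr1 [n%:R * _]mulrC -mulrBr => /eqP.
  by rewrite mulf_eq0 mulrC -NE (negPf Nm_neq0) subr_eq0 => /eqP.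
have Vv : V = v by rewrite vE /u -NE -αE -/U -rel -/U -/V addrAC subrr add0r.
(* From V = v, distinct exponents would make a positive power of y constant. *)
have ME : M = m.
  case: (ltngtP M m) => // Mm_lt.
    have /(y_exp_nconst (β / b))/negP[] : (0 < m - M)%N by rewrite subn_gt0.
    rewrite fmorph_div eq_sym; apply/eqP; apply: (mulIf (_ : emb b * y ^+ M != 0)).
      by rewrite mulf_neq0 ?emb_eq0 // expf_neq0 ?y_neq0.
    rewrite mulrA divfK ?emb_eq0 // -/V Vv /v mulrCA -exprD subnK // ltnW //.
  have /(y_exp_nconst (b / β))/negP[] : (0 < M - m)%N by rewrite subn_gt0.
  rewrite fmorph_div eq_sym; apply/eqP; apply: (mulIf (_ : emb β * y ^+ m != 0)).
    by rewrite mulf_neq0 ?emb_eq0 // expf_neq0 ?y_neq0.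
  by rewrite mulrA divfK ?emb_eq0 // -/v -Vv /V mulrCA -exprD subnK // ltnW.
exists 0%N; rewrite expn0 !mul1n !expr1; split=> //.
apply: (fmorph_inj emb); apply: (mulIf (expf_neq0 m y_neq0)).
by rewrite -{1}ME -/V Vv.
Qed.

(** Taking m-th powers replaces y^m by (1 - a x^n)/b and gives a polynomial identity in x. At x = 0
    one side vanishes and the other does not. *)
Lemma no_pole_x k M1 M2 (α β : F) :
  (0 < k)%N -> α != 0 -> emb β * y ^+ M1 * x ^+ k <> (x ^+ k - emb α) * y ^+ M2.
Proof.
move=> k_gt0 α_neq0 rel.
pose Q : {poly F} := 1 - a *: 'X^n.
have vE' : 1 - emb a * x ^+ n = emb b * y ^+ m by rewrite -/u -vE.
have : (β ^+ m * b ^+ M2) *: (Q ^+ M1 * 'X^(k * m))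
    - b ^+ M1 *: (('X^k - α *: 1) ^+ m * Q ^+ M2) = 0.
  apply: evx_eq0; rewrite !evE vE' rmorphM !rmorphXn mulr1.
  transitivity (emb b ^+ (M1 + M2) *
    ((emb β * y ^+ M1 * x ^+ k) ^+ m - ((x ^+ k - emb α) * y ^+ M2) ^+ m)).
    by rewrite !exprMn -!exprM ![(m * _)%N]mulnC exprD; ring.
  by rewrite rel subrr mulr0.
move/(congr1 (fun P => P.[0])); rewrite /Q !hornerE /=.
rewrite !expr0n muln_eq0 !gtn_eqF //= !mulr0 !subr0 sub0r !expr1n !mulr1 sub0r => /eqP.
rewrite oppr_eq0 mulf_eq0 !expf_eq0 oppr_eq0 (negPf α_neq0) (negPf b_neq0).
by rewrite !andbF.
Qed.

(** Taking m-th powers again, the nonconstant polynomial 1 - a X^n would divide a nonzero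
    constant. *)
Lemma no_pole_y N k (α β : F) :
  (0 < k)%N -> β != 0 -> (1 - emb α * x ^+ N) * y ^+ k <> emb β.
Proof.
move=> k_gt0 β_neq0 rel.
pose Q : {poly F} := 1 - a *: 'X^n.
have vE' : 1 - emb a * x ^+ n = emb b * y ^+ m by rewrite -/u -vE.
have c_neq0 : (β ^+ m * b ^+ k)%:P != 0 :> {poly F}.
  by rewrite polyC_eq0 mulf_neq0 // expf_neq0.
have : (1 - α *: 'X^N) ^+ m * Q ^+ k - (β ^+ m * b ^+ k) *: 1 = 0 :> {poly F}.
  apply: evx_eq0; rewrite !evE vE' rmorphM !rmorphXn !mulr1 -rel.
  by rewrite !exprMn -!exprM ![(m * _)%N]mulnC; ring.
move/eqP; rewrite subr_eq0 alg_polyC => /eqP QE.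
have /(dvdp_leq c_neq0) : Q %| (β ^+ m * b ^+ k)%:P.
  by rewrite -QE dvdp_mull // dvdp_exp.
rewrite size_polyC mulf_neq0 ?expf_neq0 // leqNgt => /negP[].
rewrite /Q addrC size_polyDl size_polyN size_scale // size_polyXn ?size_poly1 //.
Qed.

Lemma y_power_const (α β : F) k :
  β != 0 -> (0 < k)%N -> emb α + emb β * y ^+ k <> 1.
Proof.
move=> β_neq0 k_gt0 rel; have /negP[] := y_exp_nconst ((1 - α) / β) k_gt0.
rewrite fmorph_div rmorphB rmorph1 -rel addrAC subrr add0r mulrC mulKf ?emb_eq0 //.
Qed.

Lemma x_power_const (α β : F) k :
  α != 0 -> (0 < k)%N -> emb α * x ^+ k + emb β <> 1.
Proof.
move=> α_neq0 k_gt0 rel.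
have : α *: 'X^k + (β - 1) *: 1 = 0 :> {poly F}.
  by apply: evx_eq0; rewrite !evE rmorphB rmorph1 mulr1 addrA rel subrr.
move/(congr1 (fun P : {poly F} => P`_k)); rewrite !coefE eqxx gtn_eqF // mulr0 mulr1 addr0.
by move/eqP; rewrite (negPf α_neq0).
Qed.

Lemma xq_neq_x : x ^+ q != x.
Proof.
apply/negP => /eqP xq; have : 'X^q - 'X = 0 :> {poly F}.
  by apply: evx_eq0; rewrite !evE xq subrr.
move/(congr1 (fun P : {poly F} => P`_1)); rewrite !coefE eqxx ltn_eqF ?q_gt1 // sub0r.
by move/eqP; rewrite oppr_eq0 oner_eq0.
Qed.

Lemma q_odd : exists k, q = k.*2.+1.
Proof.
exists q./2; rewrite -[LHS]odd_double_half qE oddX.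
by case: (even_prime p_prime) => [p2 | ->]; [move: p_gt5; rewrite p2 | rewrite orbT].
Qed.

Lemma natF_sub_eq0 k l : (l <= k)%N -> k%:R = l%:R :> F -> (p %| k - l)%N.
Proof. by move=> lk kl; rewrite -natF_eq0 natrB // kl subrr. Qed.

(** Divisibility comes from [expn_sub1_dvd]; s = h would give N = c. *)
Lemma subfield_degree s N c :
  (0 < c < p)%N -> (c < N)%N -> (N * (p ^ s - 1) = c * (q - 1))%N -> (s < h)%N /\ (s %| h)%N.
Proof.
move=> c_p cN NE; have /andP[c_gt0 _] := c_p.
have cq_gt0 : (0 < c * (q - 1))%N by rewrite muln_gt0 c_gt0 subn_gt0 q_gt1.
have s_gt0 : (0 < s)%N by rewrite lt0n; apply: contraTneq cq_gt0 => s0; rewrite -NE s0 subnn muln0.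
have sh : (s %| h)%N.
  by apply: (expn_sub1_dvd c_p s_gt0); rewrite -qE -NE dvdn_mull.
split=> //; rewrite ltn_neqAle dvdn_leq ?h_gt0 // andbT.
apply: contraTneq cN => s_h; rewrite -leqNgt.
move/eqP: NE; rewrite s_h -qE eqn_pmul2r ?subn_gt0 ?q_gt1 // => /eqP ->.
exact: leqnn.
Qed.

Lemma exprD_mulq (f : K) e j : f ^+ (e + j * q) = f ^+ e * (f ^+ q) ^+ j.
Proof. by rewrite exprD mulnC exprM. Qed.

Lemma emb_exprB (c : F) (f : K) e j : (j <= e)%N -> emb c * f ^+ (e - j) * f ^+ j = emb c * f ^+ e.
Proof. by move=> je; rewrite -mulrA -exprD subnK. Qed.

Lemma emb_exprD (c : F) (f : K) e j : emb c * f ^+ (e + j) = emb c * f ^+ e * f ^+ j.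
Proof. by rewrite exprD mulrA. Qed.

(** For residue 1/2, p divides 2e - 1, so this exhibits the square of c f^e as a constant of [D 1]
    times f. *)
Lemma emb_sqr (c : F) (f : K) e : (0 < e)%N ->
  emb (c ^+ 2) * f ^+ (2 * e - 1) * f = (emb c * f ^+ e) ^+ 2.
Proof.
move=> e0; rewrite rmorphXn exprMn -exprM -[in _ * f]mulrA -exprSr mulnC.
by congr (_ * _ ^+ _); lia.
Qed.

Lemma emb_sqr_q (c : F) (f : K) e k : (0 < e)%N -> q = k.*2.+1 ->
  emb (c ^+ 2) * f ^+ (2 * e - 1) * f ^+ q = (emb c * f ^+ (e + k)) ^+ 2.
Proof.
move=> e0 qk; rewrite rmorphXn exprMn -exprM -[in _ * f ^+ _]mulrA -exprD qk.
by congr (_ * _ ^+ _); lia.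
Qed.

(** * Explicit conics for the nine pairs of residues *)

Section ConicCases.

Hypothesis y2_neq0 : D 2 y != 0.

(** Coefficients are listed in the order 1, y, y^2, x, xy, x^2, padded by 0. *)
Lemma frob_mx_conic_seq (s : seq K) :
  all (fun c => D 1 c == 0) s -> has (fun c => c != 0) s -> (size s <= 6)%N ->
  conic (nth 0 s) x y = 0 ->
  \det (frob_mx D x y q 2 (iota 0 5)) = 0 <-> conic (nth 0 s) (x ^+ q) (y ^+ q) = 0.
Proof.
move=> /allP ds /(has_nthP 0)[j j_s c_j] s6 cxy.
apply: (frob_mx_conic hasseD q pcharK p_gt5 y2_neq0) => //.
  move=> i _; have [i_s|s_i] := ltnP i (size s); first exact/eqP/ds/mem_nth.
  by rewrite nth_default // (hasse_zero hasseD).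
by exists j => //; apply: leq_trans s6.
Qed.

Let constE := (hasseDD hasseD, deriveN hasseD, deriveM hasseD, deriveX hasseD,
  derive_nat hasseD, hasse_one hasseD (ltn0Sn 0), hasse_zero hasseD, mulr0, mul0r, addr0, oppr0, eqxx).

Let const_monomial := derive_emb_expr hasseD pcharK.

Let emb_monomial_neq0 (c : F) (f : K) e : c != 0 -> f != 0 -> emb c * f ^+ e != 0.
Proof. by move=> c0 f0; rewrite mulf_neq0 ?emb_eq0 // expf_neq0. Qed.

(** Here A = a x^(n-2) and B = b y^(m-2) are killed by [D 1], and the conic is A X^2 + B Y^2 = 1.
    Residue 1 is treated likewise, with a linear term. *)
Lemma frob_conic_2_2 : (p %| n - 2)%N -> (p %| m - 2)%N ->
  \det (frob_mx D x y q 2 (iota 0 5)) = 0 <->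
  emb a * x ^+ (n - 2 + 2 * q) + emb b * y ^+ (m - 2 + 2 * q) = 1.
Proof.
move=> pn pm; pose A := emb a * x ^+ (n - 2); pose B := emb b * y ^+ (m - 2).
have [dA dB] : D 1 A = 0 /\ D 1 B = 0 by split; apply: const_monomial.
have [Ax By] : A * x ^+ 2 = u /\ B * y ^+ 2 = v by rewrite !emb_exprB // ltnW.
apply: (iff_trans (@frob_mx_conic_seq [:: - 1%:R; 0; B; 0; 0; A] _ _ _ _)) => //.
- by rewrite /= !(dA, dB, constE).
- by rewrite /= oppr_eq0 oner_eq0.
- transitivity (A * x ^+ 2 + B * y ^+ 2 - 1); first by rewrite /conic /=; ring.
  by rewrite Ax By curve subrr.
rewrite !exprD_mulq !mulrA -/A -/B.
split=> [cq | <-]; last by rewrite /conic /=; ring.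
by apply/eqP; rewrite -subr_eq0 -cq /conic /=; apply/eqP; ring.
Qed.

Lemma frob_conic_2_1 : (p %| n - 2)%N -> (p %| m - 1)%N ->
  \det (frob_mx D x y q 2 (iota 0 5)) = 0 <->
  emb a * x ^+ (n - 2 + 2 * q) + emb b * y ^+ (m - 1 + 1 * q) = 1.
Proof.
move=> pn pm; pose A := emb a * x ^+ (n - 2); pose B := emb b * y ^+ (m - 1).
have [dA dB] : D 1 A = 0 /\ D 1 B = 0 by split; apply: const_monomial.
have [Ax By] : A * x ^+ 2 = u /\ B * y ^+ 1 = v.
  by rewrite !emb_exprB // ltnW.
apply: (iff_trans (@frob_mx_conic_seq [:: - 1%:R; B; 0; 0; 0; A] _ _ _ _)) => //.
- by rewrite /= !(dA, dB, constE).
- by rewrite /= oppr_eq0 oner_eq0.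
- transitivity (A * x ^+ 2 + B * y ^+ 1 - 1); first by rewrite /conic /=; ring.
  by rewrite Ax By curve subrr.
rewrite !exprD_mulq !mulrA -/A -/B ?mul1n ?expr1.
split=> [cq | <-]; last by rewrite /conic /=; ring.
by apply/eqP; rewrite -subr_eq0 -cq /conic /=; apply/eqP; ring.
Qed.

Lemma frob_conic_1_2 : (p %| n - 1)%N -> (p %| m - 2)%N ->
  \det (frob_mx D x y q 2 (iota 0 5)) = 0 <->
  emb a * x ^+ (n - 1 + 1 * q) + emb b * y ^+ (m - 2 + 2 * q) = 1.
Proof.
move=> pn pm; pose A := emb a * x ^+ (n - 1); pose B := emb b * y ^+ (m - 2).
have [dA dB] : D 1 A = 0 /\ D 1 B = 0 by split; apply: const_monomial.
have [Ax By] : A * x ^+ 1 = u /\ B * y ^+ 2 = v.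
  by rewrite !emb_exprB // ltnW.
apply: (iff_trans (@frob_mx_conic_seq [:: - 1%:R; 0; B; A; 0; 0] _ _ _ _)) => //.
- by rewrite /= !(dA, dB, constE).
- by rewrite /= oppr_eq0 oner_eq0.
- transitivity (A * x ^+ 1 + B * y ^+ 2 - 1); first by rewrite /conic /=; ring.
  by rewrite Ax By curve subrr.
rewrite !exprD_mulq !mulrA -/A -/B ?mul1n ?expr1.
split=> [cq | <-]; last by rewrite /conic /=; ring.
by apply/eqP; rewrite -subr_eq0 -cq /conic /=; apply/eqP; ring.
Qed.

(** Now u^2 = A x and v^2 = B y. Rationalising u + v = 1 gives the conic (1 - AX - BY)^2 = 4AB XY.
    As q is odd, AX and BY are squares at the Frobenius image too, and the equation splits into four
    factors. *)
Lemma frob_conic_half_half k : q = k.*2.+1 -> (p %| 2 * n - 1)%N -> (p %| 2 * m - 1)%N ->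
  \det (frob_mx D x y q 2 (iota 0 5)) = 0 <->
  let U := emb a * x ^+ (n + k) in let V := emb b * y ^+ (m + k) in
  (1 - U - V) * (1 + U + V) * (1 - U + V) * (1 + U - V) = 0.
Proof.
move=> qk pn pm; pose A := emb (a ^+ 2) * x ^+ (2 * n - 1); pose B := emb (b ^+ 2) * y ^+ (2 * m - 1).
have [dA dB] : D 1 A = 0 /\ D 1 B = 0 by split; apply: const_monomial.
have [Ax By] : A * x = u ^+ 2 /\ B * y = v ^+ 2.
  by split; apply: emb_sqr.
apply: (iff_trans (@frob_mx_conic_seq
  [:: 1; - (2%:R * B); B * B; - (2%:R * A); - (2%:R * (A * B)); A * A] _ _ _ _)) => //.
- by rewrite /= !(dA, dB, constE).
- by rewrite /= oner_eq0.
- transitivity ((1 - A * x - B * y) ^+ 2 - 4%:R * (A * x) * (B * y)); first by rewrite /conic /=; ring.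
  by rewrite Ax By vE; ring.
cbv zeta; set U := emb a * x ^+ (n + k); set V := emb b * y ^+ (m + k).
have [UE VE] : A * x ^+ q = U ^+ 2 /\ B * y ^+ q = V ^+ 2.
  by rewrite /A /B !(emb_sqr_q _ _ _ qk) //.
rewrite (_ : (1 - U - V) * _ * _ * _ = (1 - U ^+ 2 - V ^+ 2) ^+ 2 - 4%:R * U ^+ 2 * V ^+ 2);
  last by ring.
rewrite -UE -VE (_ : conic _ _ _ = (1 - A * x ^+ q - B * y ^+ q) ^+ 2
  - 4%:R * (A * x ^+ q) * (B * y ^+ q)) //.
by rewrite /conic /=; ring.
Qed.

(** Only v needs squaring: the conic is (1 - AX)^2 = BY. *)
Lemma frob_conic_1_half k : q = k.*2.+1 -> (p %| n - 1)%N -> (p %| 2 * m - 1)%N ->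
  \det (frob_mx D x y q 2 (iota 0 5)) = 0 <->
  (1 - emb a * x ^+ (n - 1 + 1 * q)) ^+ 2 = (emb b * y ^+ (m + k)) ^+ 2.
Proof.
move=> qk pn pm; pose A := emb a * x ^+ (n - 1); pose B := emb (b ^+ 2) * y ^+ (2 * m - 1).
have [dA dB] : D 1 A = 0 /\ D 1 B = 0 by split; apply: const_monomial.
have [Ax By] : A * x ^+ 1 = u /\ B * y = v ^+ 2.
  by split; [apply: emb_exprB | apply: emb_sqr].
apply: (iff_trans (@frob_mx_conic_seq [:: 1; - B; 0; - (2%:R * A); 0; A * A] _ _ _ _)) => //.
- by rewrite /= !(dA, dB, constE).
- by rewrite /= oner_eq0.
- transitivity ((1 - A * x ^+ 1) ^+ 2 - B * y); first by rewrite /conic /=; ring.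
  by rewrite Ax By vE subrr.
have VE : B * y ^+ q = (emb b * y ^+ (m + k)) ^+ 2 by rewrite /B (emb_sqr_q _ _ _ qk) //.
rewrite -VE exprD_mulq mulrA -/A expr1.
split=> [cq | e]; first by apply/eqP; rewrite -subr_eq0 -cq /conic /=; apply/eqP; ring.
by transitivity ((1 - A * x ^+ q) ^+ 2 - B * y ^+ q); [rewrite /conic /=; ring | rewrite e subrr].
Qed.

Lemma frob_conic_half_1 k : q = k.*2.+1 -> (p %| 2 * n - 1)%N -> (p %| m - 1)%N ->
  \det (frob_mx D x y q 2 (iota 0 5)) = 0 <->
  (1 - emb b * y ^+ (m - 1 + 1 * q)) ^+ 2 = (emb a * x ^+ (n + k)) ^+ 2.
Proof.
move=> qk pn pm; pose A := emb (a ^+ 2) * x ^+ (2 * n - 1); pose B := emb b * y ^+ (m - 1).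
have [dA dB] : D 1 A = 0 /\ D 1 B = 0 by split; apply: const_monomial.
have [Ax By] : A * x = u ^+ 2 /\ B * y ^+ 1 = v.
  by split; [apply: emb_sqr | apply: emb_exprB].
apply: (iff_trans (@frob_mx_conic_seq [:: 1; - (2%:R * B); B * B; - A; 0; 0] _ _ _ _)) => //.
- by rewrite /= !(dA, dB, constE).
- by rewrite /= oner_eq0.
- transitivity ((1 - B * y ^+ 1) ^+ 2 - A * x); first by rewrite /conic /=; ring.
  by rewrite Ax By vE; ring.
have UE : A * x ^+ q = (emb a * x ^+ (n + k)) ^+ 2 by rewrite /A (emb_sqr_q _ _ _ qk) //.
rewrite -UE exprD_mulq mulrA -/B expr1.
split=> [cq | e]; first by apply/eqP; rewrite -subr_eq0 -cq /conic /=; apply/eqP; ring.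
by transitivity ((1 - B * y ^+ q) ^+ 2 - A * x ^+ q); [rewrite /conic /=; ring | rewrite e subrr].
Qed.

(** Here u = A/x and v = B/y, so the conic is the hyperbola AY + BX = XY. *)
Lemma frob_conic_N1_N1 : (p %| n + 1)%N -> (p %| m + 1)%N ->
  \det (frob_mx D x y q 2 (iota 0 5)) = 0 <->
  emb a * x ^+ (n + 1) * y ^+ q + emb b * y ^+ (m + 1) * x ^+ q = x ^+ q * y ^+ q.
Proof.
move=> pn pm; pose A := emb a * x ^+ (n + 1); pose B := emb b * y ^+ (m + 1).
have [dA dB] : D 1 A = 0 /\ D 1 B = 0 by split; apply: const_monomial.
have [Ax By] : A = u * x /\ B = v * y.
  by split; apply: emb_exprD.
apply: (iff_trans (@frob_mx_conic_seq [:: 0; A; 0; B; - 1%:R; 0] _ _ _ _)) => //.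
- by rewrite /= !(dA, dB, constE).
- by rewrite /= ?eqxx emb_monomial_neq0 ?x_neq0 ?orbT.
- transitivity (A * y + B * x - x * y); first by rewrite /conic /=; ring.
  by rewrite Ax By vE; ring.
rewrite -/A -/B.
split=> [cq | e]; first by apply/eqP; rewrite -subr_eq0 -cq /conic /=; apply/eqP; ring.
by transitivity ((A * y ^+ q + B * x ^+ q) - x ^+ q * y ^+ q); [rewrite /conic /=; ring | rewrite e subrr].
Qed.

(** The relation AX + B/Y = 1, cleared of its denominator. *)
Lemma frob_conic_1_N1 : (p %| n - 1)%N -> (p %| m + 1)%N ->
  \det (frob_mx D x y q 2 (iota 0 5)) = 0 <->
  emb a * x ^+ (n - 1 + 1 * q) * y ^+ q + emb b * y ^+ (m + 1) = y ^+ q.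
Proof.
move=> pn pm; pose A := emb a * x ^+ (n - 1); pose B := emb b * y ^+ (m + 1).
have [dA dB] : D 1 A = 0 /\ D 1 B = 0 by split; apply: const_monomial.
have [Ax By] : A * x ^+ 1 = u /\ B = v * y.
  by split; [apply: emb_exprB | apply: emb_exprD].
apply: (iff_trans (@frob_mx_conic_seq [:: B; - 1%:R; 0; 0; A; 0] _ _ _ _)) => //.
- by rewrite /= !(dA, dB, constE).
- by rewrite /= emb_monomial_neq0 ?y_neq0.
- transitivity (A * x ^+ 1 * y + B - y); first by rewrite /conic /=; ring.
  by rewrite Ax By vE; ring.
rewrite exprD_mulq mulrA -/A -/B expr1.
split=> [cq | e]; first by apply/eqP; rewrite -subr_eq0 -cq /conic /=; apply/eqP; ring.
by transitivity ((A * x ^+ q * y ^+ q + B) - y ^+ q); [rewrite /conic /=; ring | rewrite e subrr].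
Qed.

Lemma frob_conic_N1_1 : (p %| n + 1)%N -> (p %| m - 1)%N ->
  \det (frob_mx D x y q 2 (iota 0 5)) = 0 <->
  emb a * x ^+ (n + 1) + emb b * y ^+ (m - 1 + 1 * q) * x ^+ q = x ^+ q.
Proof.
move=> pn pm; pose A := emb a * x ^+ (n + 1); pose B := emb b * y ^+ (m - 1).
have [dA dB] : D 1 A = 0 /\ D 1 B = 0 by split; apply: const_monomial.
have [Ax By] : A = u * x /\ B * y ^+ 1 = v.
  by split; [apply: emb_exprD | apply: emb_exprB].
apply: (iff_trans (@frob_mx_conic_seq [:: A; 0; 0; - 1%:R; B; 0] _ _ _ _)) => //.
- by rewrite /= !(dA, dB, constE).
- by rewrite /= emb_monomial_neq0 ?x_neq0.
- transitivity (A + B * y ^+ 1 * x - x); first by rewrite /conic /=; ring.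
  by rewrite Ax By vE; ring.
rewrite exprD_mulq mulrA -/A -/B expr1.
split=> [cq | e]; first by apply/eqP; rewrite -subr_eq0 -cq /conic /=; apply/eqP; ring.
by transitivity ((A + B * y ^+ q * x ^+ q) - x ^+ q); [rewrite /conic /=; ring | rewrite e subrr].
Qed.

End ConicCases.

(** * Exponents, fields of definition and poles *)

Lemma exponent_power e j s :
  (j <= e)%N -> (e - j + j * q = p ^ s * e)%N <-> (e * (p ^ s - 1) = j * (q - 1))%N.
Proof.
move=> je; rewrite !mulnBr !muln1 [(p ^ s * e)%N]mulnC.
have := leq_pmulr e (_ : 0 < p ^ s)%N; rewrite expn_gt0 prime_gt0 // => /(_ isT).
have := leq_pmulr j (ltnW q_gt1); move: (e * p ^ s)%N (j * q)%N => A B.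
by clear -je; lia.
Qed.

Lemma half_exponent_power e k s :
  q = k.*2.+1 -> (e + k = p ^ s * e)%N <-> (e * (2 * (p ^ s - 1)) = q - 1)%N.
Proof.
move=> ->; rewrite mulnCA mulnBr muln1 [(p ^ s * e)%N]mulnC.
have := leq_pmulr e (_ : 0 < p ^ s)%N; rewrite expn_gt0 prime_gt0 // => /(_ isT).
by move: (e * p ^ s)%N => A; clear; lia.
Qed.

Lemma curve_frobenius s :
  emb (a ^+ (p ^ s)) * x ^+ (p ^ s * n) + emb (b ^+ (p ^ s)) * y ^+ (p ^ s * m) = 1.
Proof.
rewrite !rmorphXn ![(p ^ s * _)%N]mulnC !exprM -!exprMn -frobeniusD -/u -/v.
by rewrite [u + v]curve expr1n.
Qed.

Lemma frobenius_oppr s (c : F) : (- c) ^+ (p ^ s) = - c ^+ (p ^ s).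
Proof. by rewrite exprNn_pchar // pnatX pnatE // pcharF. Qed.

(** Write h = dr. Iterating the p^r-power map d times multiplies c by (-1)^d, but it is the q-power
    map, which fixes c; hence d is even. *)
Lemma neg_eigenvalue_degree r (c : F) :
  c != 0 -> (r %| h)%N -> c ^+ (p ^ r) = - c -> (2 * r %| h)%N.
Proof.
move=> c_neq0 /dvdnP[d hE] cr.
have c_iter i : c ^+ (p ^ (i * r)) = (-1) ^+ i * c.
  elim: i => [|i IHi]; first by rewrite !mul1r.
  rewrite mulSn expnD exprM cr frobenius_oppr IHi exprS; ring.
have := c_iter d; rewrite -hE -qE -cardF expf_card => cd.
rewrite hE dvdn_mul // dvdn2; apply: contraL isT => d_odd.
have {}cd : c = - c by rewrite [LHS]cd -signr_odd d_odd expr1 mulN1r.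
have : 2%:R * c == 0 by rewrite mulr_natl mulr2n {2}cd subrr.
by rewrite mulf_eq0 (negPf c_neq0) orbF natF_eq0 gtnNdvd // (leq_trans _ p_gt5).
Qed.

Lemma fermat_power_le N M (α β : F) :
  (0 < N)%N -> (0 < M)%N -> α != 0 -> β != 0 ->
  emb α * x ^+ N + emb β * y ^+ M = 1 -> (n <= N)%N /\ (m <= M)%N.
Proof.
move=> N0 M0 α0 β0 /(fermat_power N0 M0 α0 β0)[s [-> -> _ _]].
by split; apply: leq_pmull; rewrite expn_gt0 prime_gt0.
Qed.

Lemma pole_cancel_x (W V : K) :
  (q <= n.+1)%N -> emb a * x ^+ (n + 1) * W + V * x ^+ q = x ^+ q * W ->
  emb a * x ^+ (n.+1 - q) * W + V = W.
Proof.
move=> qn rel; apply: (mulIf (expf_neq0 q x_neq0)).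
by rewrite [RHS]mulrC -rel addn1 -[in RHS](subnK qn) exprD; ring.
Qed.

(** If q exceeded n + 1, dividing by x^(n+1) would leave a relation excluded by [no_pole_x]. *)
Lemma pole_relation_x M (W : K) :
  emb a * x ^+ (n + 1) * y ^+ M + W * x ^+ q = x ^+ q * y ^+ M ->
  (exists M' β, W = emb β * y ^+ M') -> (q <= n.+1)%N.
Proof.
move=> rel [M' [β WE]]; rewrite leqNgt; apply/negP => nq.
have k_gt0 : (0 < q - n.+1)%N by rewrite subn_gt0.
apply: (@no_pole_x _ M' M a β k_gt0 a_neq0).
apply: (mulIf (expf_neq0 n.+1 x_neq0)).
have xqE : x ^+ q = x ^+ (q - n.+1) * x ^+ n.+1 by rewrite -exprD subnK // ltnW.
rewrite -WE -mulrA -xqE.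
have -> : W * x ^+ q = x ^+ q * y ^+ M - emb a * x ^+ (n + 1) * y ^+ M by rewrite -rel; ring.
by rewrite xqE addn1; ring.
Qed.

(** By [no_pole_y], q is at most m + 1, so y^q cancels and a Fermat relation with y-exponent m + 1 -
    q < m remains. Such a relation cannot have positive exponents, and a single zero exponent is
    impossible, so both are zero and a + b = 1. *)
Lemma pole_relation_y N :
  emb a * x ^+ N * y ^+ q + emb b * y ^+ (m + 1) = y ^+ q ->
  [/\ N = 0%N, q = m.+1 & a + b = 1].
Proof.
move=> rel; have qm : (q <= m.+1)%N.
  rewrite leqNgt; apply/negP => mq.
  apply: (@no_pole_y N _ a b (_ : 0 < q - m.+1)%N b_neq0); first by rewrite subn_gt0.
  apply: (mulIf (expf_neq0 m.+1 y_neq0)).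
  by rewrite -mulrA -exprD subnK 1?ltnW // mulrBl mul1r -{1}rel addn1; ring.
have {}rel : emb a * x ^+ N + emb b * y ^+ (m.+1 - q) = 1.
  apply: (mulIf (expf_neq0 q y_neq0)).
  by rewrite mulrDl -[_ * y ^+ (_ - _) * _]mulrA -exprD subnK // -addn1 rel mul1r.
have [M0|M_gt0] := posnP (m.+1 - q).
  move: rel; rewrite M0 expr0 mulr1; have [-> rel|N_gt0 /x_power_const[]//] := posnP N.
  split=> //; first by apply/eqP; rewrite eqn_leq qm -subn_eq0 M0.
  by apply: (fmorph_inj emb); rewrite rmorphD rmorph1 -rel expr0 mulr1.
have [N0|N_gt0] := posnP N.
  by move: rel; rewrite N0 expr0 mulr1 => /(y_power_const b_neq0 M_gt0).
have [_] := fermat_power_le N_gt0 M_gt0 a_neq0 b_neq0 rel.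
by have := q_gt1; have := m_gt0; clear; lia.
Qed.

(** * Which pairs of residues occur, and for which exponents and coefficients *)

Section Classification.

Hypotheses (y2_neq0 : D 2 y != 0) (m_le_n : (m <= n)%N).

Let frob_det_eq0 := \det (frob_mx D x y q 2 (iota 0 5)) = 0.

Let exponent_gt0 e j : (0 < j)%N -> (0 < e + j * q)%N.
Proof. by move=> j_gt0; rewrite addn_gt0 muln_gt0 j_gt0 (ltnW q_gt1) orbT. Qed.

Let p_gt1 : (0 < 1 < p)%N. Proof. exact: prime_gt1. Qed.
Let p_gt2 : (0 < 2 < p)%N. Proof. exact: leq_trans p_gt5. Qed.
Let n_ge1 : (1 <= n)%N. Proof. by []. Qed.
Let m_ge1 : (1 <= m)%N. Proof. by []. Qed.
Let n_ge2 : (2 <= n)%N. Proof. exact: ltnW. Qed.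
Let m_ge2 : (2 <= m)%N. Proof. exact: ltnW. Qed.

Let p_sub1_gt0 s c : (0 < c)%N -> (n * (p ^ s - 1) = c * (q - 1))%N -> (0 < p ^ s - 1)%N.
Proof.
move=> c_gt0 nE; have : (0 < n * (p ^ s - 1))%N by rewrite nE muln_gt0 c_gt0 subn_gt0 q_gt1.
by rewrite muln_gt0 => /andP[].
Qed.

Lemma frob_nonclassical_2_2 : (p %| n - 2)%N -> (p %| m - 2)%N -> frob_det_eq0 ->
  m = n /\ exists r, [/\ (r < h)%N, (r %| h)%N, (n * (p ^ r - 1) = 2 * (q - 1))%N,
                       in_subfield p r a & in_subfield p r b].
Proof.
move=> pn pm /(frob_conic_2_2 y2_neq0 pn pm) rel.
have [s [nE mE aE bE]] :=
  fermat_power (exponent_gt0 _ (ltn0Sn 1)) (exponent_gt0 _ (ltn0Sn 1)) a_neq0 b_neq0 rel.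
move/(exponent_power s n_ge2): nE => nE; move/(exponent_power s m_ge2): mE => mE.
have [sh s_h] := subfield_degree p_gt2 n_gt2 nE.
split; last by exists s; split=> //; apply/eqP.
by apply/eqP; rewrite -(eqn_pmul2r (p_sub1_gt0 _ nE)) // nE mE.
Qed.

Lemma frob_nonclassical_2_1 : (p %| n - 2)%N -> (p %| m - 1)%N -> frob_det_eq0 ->
  n = (2 * m)%N /\ exists r, [/\ (r < h)%N, (r %| h)%N, (n * (p ^ r - 1) = 2 * (q - 1))%N,
                       in_subfield p r a & in_subfield p r b].
Proof.
move=> pn pm /(frob_conic_2_1 y2_neq0 pn pm) rel.
have [s [nE mE aE bE]] :=
  fermat_power (exponent_gt0 _ (ltn0Sn 1)) (exponent_gt0 _ (ltn0Sn 0)) a_neq0 b_neq0 rel.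
move/(exponent_power s n_ge2): nE => nE; move/(exponent_power s m_ge1): mE => mE.
have [sh s_h] := subfield_degree p_gt2 n_gt2 nE.
split; last by exists s; split=> //; apply/eqP.
by apply/eqP; rewrite -(eqn_pmul2r (p_sub1_gt0 _ nE)) // nE -mulnA mE mul1n.
Qed.

(** Comparing exponents would give m = 2n, against m <= n. *)
Lemma frob_classical_1_2 : (p %| n - 1)%N -> (p %| m - 2)%N -> ~ frob_det_eq0.
Proof.
move=> pn pm /(frob_conic_1_2 y2_neq0 pn pm) rel.
have [s [nE mE _ _]] :=
  fermat_power (exponent_gt0 _ (ltn0Sn 0)) (exponent_gt0 _ (ltn0Sn 1)) a_neq0 b_neq0 rel.
move/(exponent_power s n_ge1): nE => nE; move/(exponent_power s m_ge2): mE => mE.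
have : m = (2 * n)%N.
  by apply/eqP; rewrite -(eqn_pmul2r (p_sub1_gt0 _ nE)) // mE -mulnA nE mul1n.
by have := m_le_n; have := n_gt0; clear; lia.
Qed.

Let half_exponent_gt0 e k : (0 < e)%N -> (0 < e + k)%N.
Proof. by move=> e_gt0; rewrite addn_gt0 e_gt0. Qed.

Lemma frob_nonclassical_half_half : (p %| 2 * n - 1)%N -> (p %| 2 * m - 1)%N -> frob_det_eq0 ->
  m = n /\ exists r, [/\ (r < h)%N, (r %| h)%N, (n * (2 * (p ^ r - 1)) = q - 1)%N,
                       in_subfield p r (a ^+ 2) & in_subfield p r (b ^+ 2)].
Proof.
move=> pn pm; have [k qk] := q_odd; move=> /(frob_conic_half_half y2_neq0 qk pn pm).
cbv zeta; set U := emb a * _; set V := emb b * _ => UV.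
(* The four factors are the four choices of sign for a and b, which is why only the squares are
   controlled at the end. *)
have [α [β [αa βb rel]]] : exists α, exists β, [/\ α ^+ 2 = a ^+ 2, β ^+ 2 = b ^+ 2 &
    emb α * x ^+ (n + k) + emb β * y ^+ (m + k) = 1].
  move/eqP: UV; rewrite mulf_eq0 => /orP[|]; first rewrite mulf_eq0 => /orP[|];
    first rewrite mulf_eq0 => /orP[|]; move=> /eqP UV;
    [exists a, b | exists (- a), (- b) | exists a, (- b) | exists (- a), b];
    by rewrite ?sqrrN ?rmorphN ?mulNr -/U -/V; split=> //; rewrite -[RHS]subr0 -[in RHS]UV; ring.
have sqr_neq0 (c d : F) : c ^+ 2 = d ^+ 2 -> d != 0 -> c != 0.
  by move=> cd; apply: contraNneq => c0; move/eqP: cd; rewrite c0 expr0n eq_sym expf_eq0.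
have [s [nE mE aE bE]] := fermat_power (half_exponent_gt0 _ n_gt0) (half_exponent_gt0 _ m_gt0)
  (sqr_neq0 _ _ αa a_neq0) (sqr_neq0 _ _ βb b_neq0) rel.
move/(half_exponent_power _ s qk): nE => nE; move/(half_exponent_power _ s qk): mE => mE.
(* The factor 2 is moved to the exponent: 2n(p^s - 1) = q - 1. *)
have [sh s_h] : (s < h)%N /\ (s %| h)%N.
  apply: (@subfield_degree s (n * 2) 1 p_gt1); first by have := n_gt2; clear; lia.
  by rewrite -mulnA nE mul1n.
split; last first.
  exists s; split=> //; apply/eqP; [rewrite -[RHS]αa aE | rewrite -[RHS]βb bE]; exact: exprAC.
have : (0 < n * (2 * (p ^ s - 1)))%N by rewrite nE subn_gt0 q_gt1.
rewrite muln_gt0 => /andP[_ ps]; apply/eqP.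
by rewrite -(eqn_pmul2r ps) nE mE.
Qed.

(** The square leaves the sign of b open. The sign + puts b in the field of p^s elements; the sign -
    gives b^(p^s) = -b, so b lies in the quadratic extension and 2s divides h. *)
Lemma frob_nonclassical_1_half : (p %| n - 1)%N -> (p %| 2 * m - 1)%N -> frob_det_eq0 ->
  n = (2 * m)%N /\ exists r, [/\ (r < h)%N, (r %| h)%N, (n * (p ^ r - 1) = q - 1)%N &
    (in_subfield p r a && in_subfield p r b) \/
    [/\ (2 * r %| h)%N, in_subfield p r a, in_subfield p (2 * r) b & b ^+ (p ^ r) = - b]].
Proof.
move=> pn pm; have [k qk] := q_odd; move=> /(frob_conic_1_half y2_neq0 qk pn pm).
set U := emb a * _; set V := emb b * _ => /eqP; rewrite eqf_sqr => UV.
have [β [βb rel]] : exists β, (β = b \/ β = - b) /\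
    emb a * x ^+ (n - 1 + 1 * q) + emb β * y ^+ (m + k) = 1.
  case/orP: UV => /eqP UV; [exists b | exists (- b)]; split; rewrite ?rmorphN ?mulNr;
    [by left | | by right | ]; by rewrite -/U -/V -UV; ring.
have β_neq0 : β != 0 by case: βb => ->; rewrite ?oppr_eq0.
have [s [nE mE aE bE]] := fermat_power (exponent_gt0 _ (ltn0Sn 0)) (half_exponent_gt0 _ m_gt0)
  a_neq0 β_neq0 rel.
move/(exponent_power s n_ge1): nE => nE; move/(half_exponent_power _ s qk): mE => mE.
have [sh s_h] := subfield_degree p_gt1 (ltnW n_gt2) nE.
have a_s : in_subfield p s a by apply/eqP.
split.
  apply/eqP; rewrite -(eqn_pmul2r (p_sub1_gt0 _ nE)) // nE mul1n -mE.
  by rewrite mulnCA mulnA.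
exists s; split=> //; first by rewrite nE mul1n.
case: βb bE => -> bE; [by left; rewrite a_s; apply/eqP | right].
have b_s : b ^+ (p ^ s) = - b by [].
split=> //; first exact: neg_eigenvalue_degree b_s.
by apply/eqP; rewrite mul2n -addnn expnD exprM b_s frobenius_oppr b_s opprK.
Qed.

Lemma frob_classical_half_1 : (p %| 2 * n - 1)%N -> (p %| m - 1)%N -> ~ frob_det_eq0.
Proof.
move=> pn pm; have [k qk] := q_odd; move=> /(frob_conic_half_1 y2_neq0 qk pn pm).
set U := emb a * _; set V := emb b * _ => /eqP; rewrite eqf_sqr => UV.
have [α [α_neq0 rel]] : exists α, α != 0 /\
    emb α * x ^+ (n + k) + emb b * y ^+ (m - 1 + 1 * q) = 1.
  case/orP: UV => /eqP UV; [exists a | exists (- a)]; split; rewrite ?oppr_eq0 //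
    ?rmorphN ?mulNr; by rewrite -/U -/V -UV; ring.
have [s [nE mE _ _]] := fermat_power (half_exponent_gt0 _ n_gt0) (exponent_gt0 _ (ltn0Sn 0))
  α_neq0 b_neq0 rel.
move/(half_exponent_power _ s qk): nE => nE; move/(exponent_power s m_ge1): mE => mE.
have : (0 < m * (p ^ s - 1))%N by rewrite mE mul1n subn_gt0 q_gt1.
rewrite muln_gt0 => /andP[_ ps].
have : m = (2 * n)%N.
  by apply/eqP; rewrite -(eqn_pmul2r ps) mE mul1n -nE mulnCA mulnA.
by have := m_le_n; have := n_gt0; clear; lia.
Qed.

Lemma frob_nonclassical_N1_N1 : (p %| n + 1)%N -> (p %| m + 1)%N -> frob_det_eq0 ->
  [/\ q = n.+1, q = m.+1 & a + b = 1].
Proof.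
move=> pn pm /(frob_conic_N1_N1 y2_neq0 pn pm) rel.
have qn : (q <= n.+1)%N by apply: (pole_relation_x rel); exists (m + 1)%N, b.
have [N0 qm ab] := pole_relation_y (pole_cancel_x qn rel).
by split=> //; apply/eqP; rewrite eqn_leq qn -subn_eq0 N0.
Qed.

Lemma frob_classical_1_N1 : (p %| n - 1)%N -> (p %| m + 1)%N -> ~ frob_det_eq0.
Proof.
move=> pn pm /(frob_conic_1_N1 y2_neq0 pn pm) /pole_relation_y[+ _ _].
by apply/eqP; rewrite -lt0n exponent_gt0.
Qed.

Lemma frob_classical_N1_1 : (p %| n + 1)%N -> (p %| m - 1)%N -> ~ frob_det_eq0.
Proof.
move=> pn pm /(frob_conic_N1_1 y2_neq0 pn pm) rel.
(* The factor 1 stands for y^0, to match the shape of the pole lemmas. *)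
have {}rel : emb a * x ^+ (n + 1) * 1 + emb b * y ^+ (m - 1 + 1 * q) * x ^+ q = x ^+ q * 1.
  by rewrite !mulr1.
have qn : (q <= n.+1)%N.
  by apply: (@pole_relation_x 0 _ rel); exists (m - 1 + 1 * q)%N, b.
have := pole_cancel_x qn rel; rewrite mulr1.
have [-> | N_gt0] := posnP (n.+1 - q).
  by rewrite expr0 mulr1 => /(y_power_const b_neq0 (exponent_gt0 _ (ltn0Sn 0))).
move/(fermat_power_le N_gt0 (exponent_gt0 _ (ltn0Sn 0)) a_neq0 b_neq0) => [+ _].
by have := q_gt1; have := n_gt0; clear; lia.
Qed.

Lemma curve_frobenius_fixed r N M :
  in_subfield p r a -> in_subfield p r b -> N = (p ^ r * n)%N -> M = (p ^ r * m)%N ->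
  emb a * x ^+ N + emb b * y ^+ M = 1.
Proof. by move=> /eqP ar /eqP br -> ->; rewrite -[in emb a]ar -[in emb b]br curve_frobenius. Qed.

Lemma frob_det_eq0_2_2 r : (p %| n - 2)%N -> m = n -> (n * (p ^ r - 1) = 2 * (q - 1))%N ->
  in_subfield p r a -> in_subfield p r b -> frob_det_eq0.
Proof.
move=> pn mn nE ar br; have pm : (p %| m - 2)%N by rewrite mn.
apply/(frob_conic_2_2 y2_neq0 pn pm)/(curve_frobenius_fixed ar br);
  by apply/exponent_power; rewrite // mn.
Qed.

Lemma frob_det_eq0_half_half r :
  (p %| 2 * n - 1)%N -> m = n -> (n * (2 * (p ^ r - 1)) = q - 1)%N ->
  in_subfield p r (a ^+ 2) -> in_subfield p r (b ^+ 2) -> frob_det_eq0.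
Proof.
move=> pn mn nE; rewrite /in_subfield ![_ ^+ 2 ^+ _]exprAC !eqf_sqr => ar br.
have pm : (p %| 2 * m - 1)%N by rewrite mn.
have [k qk] := q_odd; apply/(frob_conic_half_half y2_neq0 qk pn pm).
have [NE ME] : (n + k = p ^ r * n)%N /\ (m + k = p ^ r * m)%N.
  by split; apply/(half_exponent_power _ r qk); rewrite ?mn.
rewrite NE ME; have := curve_frobenius r; cbv zeta.
set U := emb a * _; set V := emb b * _.
(* Each choice of signs in the Frobenius twist of the curve kills one of the four factors. *)
case/orP: ar => /eqP ->; case/orP: br => /eqP ->; rewrite ?rmorphN ?mulNr -/U -/V => UV;
  [have factor0 : 1 - U - V = 0 | have factor0 : 1 - U + V = 0
   | have factor0 : 1 + U - V = 0 | have factor0 : 1 + U + V = 0];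
  by [rewrite -UV; ring | rewrite factor0 !(mul0r, mulr0)].
Qed.

Lemma frob_det_eq0_N1_N1 :
  (p %| n + 1)%N -> q = n.+1 -> q = m.+1 -> a + b = 1 -> frob_det_eq0.
Proof.
move=> pn qn qm ab; have pm : (p %| m + 1)%N by rewrite addn1 -qm p_dvd_q.
apply/(frob_conic_N1_N1 y2_neq0 pn pm); rewrite !addn1 -qn -qm.
have -> : emb a = 1 - emb b by rewrite -(rmorph1 emb) -ab rmorphD addrK.
by ring.
Qed.

Lemma frob_det_eq0_1_half r :
  (p %| n - 1)%N -> n = (2 * m)%N -> (n * (p ^ r - 1) = q - 1)%N ->
  in_subfield p r a -> b ^+ (p ^ r) = b \/ b ^+ (p ^ r) = - b -> frob_det_eq0.
Proof.
move=> pn nm nE /eqP ar br; have pm : (p %| 2 * m - 1)%N by rewrite -nm.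
have [k qk] := q_odd; apply/(frob_conic_1_half y2_neq0 qk pn pm).
have -> : (n - 1 + 1 * q = p ^ r * n)%N by apply/exponent_power; rewrite ?mul1n.
have -> : (m + k = p ^ r * m)%N.
  by apply/(half_exponent_power _ r qk); rewrite -nE nm mulnCA mulnA.
have := curve_frobenius r; rewrite ar => <-.
by case: br => ->; rewrite ?rmorphN; ring.
Qed.

Lemma frob_det_eq0_2_1 r :
  (p %| n - 2)%N -> n = (2 * m)%N -> (n * (p ^ r - 1) = 2 * (q - 1))%N ->
  in_subfield p r a -> in_subfield p r b -> frob_det_eq0.
Proof.
move=> pn nm nE ar br; have pm : (p %| m - 1)%N.
  move: pn; rewrite nm -{2}[2%N]muln1 -mulnBr Euclid_dvdM // => /orP[/(dvdn_leq (ltn0Sn 1))|//].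
  by rewrite leqNgt (leq_trans _ p_gt5).
apply/(frob_conic_2_1 y2_neq0 pn pm)/(curve_frobenius_fixed ar br); apply/exponent_power => //.
by apply/eqP; rewrite -(@eqn_pmul2l 2) // mulnA -nm nE mul1n.
Qed.

(** Of the nine residue pairs, (1, -1), (-1, 1), (1, 2) and (1/2, 1) are impossible; the other five
    give the five alternatives. *)
Lemma frob_det_eq0E : frob_det_eq0 <->
   (   ((p %| n - 2)%N /\ m = n /\
         exists r, [/\ (r < h)%N, (r %| h)%N, (n * (p ^ r - 1) = 2 * (q - 1))%N,
                       in_subfield p r a & in_subfield p r b]) \/
       ((p %| 2 * n - 1)%N /\ m = n /\
         exists r, [/\ (r < h)%N, (r %| h)%N, (n * (2 * (p ^ r - 1)) = q - 1)%N,
                       in_subfield p r (a ^+ 2) & in_subfield p r (b ^+ 2)]) \/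
       [/\ (p %| n + 1)%N, q = n.+1, q = m.+1 & a + b = 1] \/
       ((p %| n - 1)%N /\ n = (2 * m)%N /\
         exists r, [/\ (r < h)%N, (r %| h)%N, (n * (p ^ r - 1) = q - 1)%N &
           ((in_subfield p r a && in_subfield p r b) \/
            [/\ (2 * r %| h)%N, in_subfield p r a, in_subfield p (2 * r) b &
                b ^+ (p ^ r) = - b])]) \/
       ((p %| n - 2)%N /\ n = (2 * m)%N /\
         exists r, [/\ (r < h)%N, (r %| h)%N, (n * (p ^ r - 1) = 2 * (q - 1))%N,
                       in_subfield p r a & in_subfield p r b])).
Proof.
split; last first.
  case=> [[pn [mn [r [_ _ nE ar br]]]] | [[pn [mn [r [_ _ nE ar br]]]] | [[] |
    [[pn [nm [r [_ _ nE fixed]]]] | [pn [nm [r [_ _ nE ar br]]]]]]]].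
  - exact: frob_det_eq0_2_2 nE ar br.
  - exact: frob_det_eq0_half_half nE ar br.
  - exact: frob_det_eq0_N1_N1.
  - case: fixed => [/andP[ar /eqP br] | [_ ar _ br]];
      by apply: frob_det_eq0_1_half nE ar _; [.. | by [left | right]].
  - exact: frob_det_eq0_2_1 nE ar br.
move=> det0; have sub := natF_sub_eq0.
have half k : (0 < k)%N -> 2%:R * k%:R = 1 :> F -> (p %| 2 * k - 1)%N.
  by move=> k_gt0 k1; apply: sub; rewrite ?muln_gt0 // natrM.
have neg k : k%:R = -1 :> F -> (p %| k + 1)%N.
  by move=> k1; rewrite -natF_eq0 natrD k1 addNr.
have mg0 := frob_mx_monge hasseD pcharK p_gt5 p_dvd_q y2_neq0 xq_neq_x det0.
case: (fermat_monge_eq0 y2_neq0 mg0) => [[n1 [m1|m2|m1]] | [m1 [n1|n2|n1]] | [n1 m1] |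
  [[n2 m2]|[n1 m1]]].
- by case: (frob_classical_1_N1 (sub _ _ n_ge1 n1) (neg _ m1) det0).
- by case: (frob_classical_1_2 (sub _ _ n_ge1 n1) (sub _ _ m_ge2 m2) det0).
- do 3 right; left; have pn := sub _ _ n_ge1 n1; split=> //.
  exact: frob_nonclassical_1_half pn (half _ m_gt0 m1) det0.
- by case: (frob_classical_N1_1 (neg _ n1) (sub _ _ m_ge1 m1) det0).
- do 4 right; have pn := sub _ _ n_ge2 n2; split=> //.
  exact: frob_nonclassical_2_1 pn (sub _ _ m_ge1 m1) det0.
- by case: (frob_classical_half_1 (half _ n_gt0 n1) (sub _ _ m_ge1 m1) det0).
- do 2 right; left; have pn := neg _ n1.
  by have [qn qm ab] := frob_nonclassical_N1_N1 pn (neg _ m1) det0.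
- left; have pn := sub _ _ n_ge2 n2; split=> //.
  exact: frob_nonclassical_2_2 pn (sub _ _ m_ge2 m2) det0.
- right; left; have pn := half _ n_gt0 n1; split=> //.
  exact: frob_nonclassical_half_half pn (half _ m_gt0 m1) det0.
Qed.

End Classification.

End FermatCurve.

Unset Implicit Arguments. Set Strict Implicit. Set Printing Implicit Defensive.

Theorem theorem3p18 (p h q n m : nat) (F : finFieldType) (a b : F)
    (K : fieldType) (emb : {rmorphism F -> K}) (x y : K) (D : nat -> K -> K) :
  prime p -> (5 < p)%N -> q = (p ^ h)%N -> #|F| = q ->
  a != 0 -> b != 0 -> (2 < m)%N -> (m <= n)%N -> ~~ (p %| m * n)%N ->
  (* K contains the function field of the curve: x transcendental over F_q,
     and a x^n + b y^m = 1 *)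
  (forall P : {poly F}, P != 0 -> (map_poly emb P).[x] != 0) ->
  emb a * x ^+ n + emb b * y ^+ m = 1 ->
  (* D = Hasse derivatives w.r.t. the separating element x *)
  hasse_derivation emb x D ->
  classical D x y 1 ->
  (frob_nonclassical D x y q 2 <->
   (   ((p %| n - 2)%N /\ m = n /\
         exists r, [/\ (r < h)%N, (r %| h)%N, (n * (p ^ r - 1) = 2 * (q - 1))%N,
                       in_subfield p r a & in_subfield p r b]) \/
       ((p %| 2 * n - 1)%N /\ m = n /\
         exists r, [/\ (r < h)%N, (r %| h)%N, (n * (2 * (p ^ r - 1)) = q - 1)%N,
                       in_subfield p r (a ^+ 2) & in_subfield p r (b ^+ 2)]) \/
       [/\ (p %| n + 1)%N, q = n.+1, q = m.+1 & a + b = 1] \/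
       ((p %| n - 1)%N /\ n = (2 * m)%N /\
         exists r, [/\ (r < h)%N, (r %| h)%N, (n * (p ^ r - 1) = q - 1)%N &
           ((in_subfield p r a && in_subfield p r b) \/
            [/\ (2 * r %| h)%N, in_subfield p r a, in_subfield p (2 * r) b &
                b ^+ (p ^ r) = - b])]) \/
       ((p %| n - 2)%N /\ n = (2 * m)%N /\
         exists r, [/\ (r < h)%N, (r %| h)%N, (n * (p ^ r - 1) = 2 * (q - 1))%N,
                       in_subfield p r a & in_subfield p r b]))).
Proof.
move=> p_prime p_gt5 qE cardF a_neq0 b_neq0 m_gt2 m_le_n p_ndvd x_transc curve hasseD classical1.
have n_gt2 := leq_trans m_gt2 m_le_n.
(* Classicality for lines enters through y_2 being nonzero. *)
have y2_neq0 := classical_lines_hasse2 hasseD classical1.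
apply: iff_trans (frob_nonclassicalE x y D q) _.
exact: (frob_det_eq0E p_prime p_gt5 qE cardF a_neq0 b_neq0 n_gt2 m_gt2 p_ndvd x_transc curve
  hasseD y2_neq0 m_le_n).
Qed.
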